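(* Let $\mathcal P_8$ be the family of all planar graphs with girth at least $8$. Then $\chi_p(\mathcal P_8)=4$.
   Context: The girth of a graph is the length of its shortest cycle (infinite for forests). An oriented graph is a directed graph with no loops and no pair of opposite arcs; an orientation of an undirected simple graph $G$ is obtained by orienting each edge. A homomorphism of oriented graphs $\vec G\to\vec H$ is a vertex map sending every arc $uv$ to an arc $\varphi(u)\varphi(v)$. To push a vertex means to reverse all arcs incident with it; the push graph $[\vec G]$ is the set of oriented graphs obtainable from $\vec G$ by pushing some set of vertices (its presentations). $[\vec G]$ admits a homomorphism to $\vec H$ if some presentation does. The push chromatic number $\chi_p([\vec G])$ is the minimum number of vertices of an oriented graph $\vec H$ with $[\vec G]\to\vec H$; $\chi_p(G)$ is the maximum of $\chi_p([\vec G])$ over all orientations $\vec G$ of $G$; for a family $\mathcal F$, $\chi_p(\mathcal F)$ is the maximum of $\chi_p(G)$ over $G\in\mathcal F$. *)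

(* Defs.v *)
From Stdlib Require Import Reals.
From mathcomp Require Import all_boot.

Set Implicit Arguments.
Unset Strict Implicit.
Unset Printing Implicit Defensive.

Definition simple_graph (T : finType) (e : rel T) : Prop :=
  symmetric e /\ irreflexive e.

(* girth >= k: every cycle (a uniq closed walk on >= 3 distinct vertices)
   has at least k vertices; forests satisfy this vacuously. *)
Definition girth_at_least (T : finType) (e : rel T) (k : nat) : Prop :=
  forall s : seq T, uniq s -> cycle e s -> 3 <= size s -> k <= size s.

(* Planarity: existence of a plane embedding in R^2.  Vertices are mapped
   injectively to points; each edge {x,y} is a continuous simple arc
   g x y : [0,1] -> R^2 from p x to p y (with g y x the reversed arc);
   arc interiors avoid all vertex points and all points of other edges. *)
Definition clamp01 (t : R) : R := Rmax R0 (Rmin R1 t).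

Definition planar (T : finType) (e : rel T) : Prop :=
  exists (p : T -> (R * R)%type) (g : T -> T -> R -> (R * R)%type),
    injective p /\
    forall x y, e x y ->
      continuity (fun t => fst (g x y (clamp01 t))) /\
          continuity (fun t => snd (g x y (clamp01 t))) /\
          g x y R0 = p x /\ g x y R1 = p y /\
          (forall t, (Rle R0 t /\ Rle t R1) -> g y x t = g x y (Rminus R1 t)) /\
          (forall t s, (Rle R0 t /\ Rle t R1) -> (Rle R0 s /\ Rle s R1) ->
               g x y t = g x y s -> t = s) /\
          (forall t z, (Rlt R0 t /\ Rlt t R1) -> g x y t <> p z) /\
          (forall x' y', e x' y' -> ~ (x' = x /\ y' = y) -> ~ (x' = y /\ y' = x) ->
             forall t s, (Rlt R0 t /\ Rlt t R1) -> (Rle R0 s /\ Rle s R1) ->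
               g x y t <> g x' y' s).

Definition orientation_of (T : finType) (e : rel T) (o : rel T) : Prop :=
  forall x y, (o x y -> e x y) /\ (e x y -> o x y (+) o y x).

Definition oriented (U : finType) (a : rel U) : Prop :=
  irreflexive a /\ forall x y, a x y -> ~~ a y x.

Definition push (T : finType) (o : rel T) (S : {set T}) : rel T :=
  fun x y => if (x \in S) (+) (y \in S) then o y x else o x y.

Definition hom (T U : finType) (o : rel T) (a : rel U) (phi : T -> U) : Prop :=
  forall x y, o x y -> a (phi x) (phi y).

(* [o] -> H for some oriented H with at most k vertices, i.e. chi_p([o]) <= k. *)
Definition push_colorable (T : finType) (o : rel T) (k : nat) : Prop :=
  exists (U : finType) (a : rel U), #|U| <= k /\ oriented a /\
    exists (S : {set T}) (phi : T -> U), hom (push o S) a phi.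

Definition in_P8 (T : finType) (e : rel T) : Prop :=
  simple_graph e /\ planar e /\ girth_at_least e 8.

(* Main.v *)
Require Import Defs.
From Stdlib Require Import Reals Lra ZArith.
From mathcomp Require Import all_boot.
From mathcomp Require Import zify.
From mathcomp Require Import boolp.
From mathcomp Require Import ssralg zmodp.

Set Implicit Arguments.
Unset Strict Implicit.
Unset Printing Implicit Defensive.

Import GRing.Theory.

(** Upper bound. A push homomorphism to a tournament [H] on four vertices is a
    homomorphism to its anti-twinned double, which has eight vertices. For [H] a
    directed triangle with a dominating vertex, a path of length 2 excludes one
    colour at its far end and a path of length 3 excludes none, so a minimal
    counterexample has minimum degree 2, no two adjacent 2-vertices, and no
    3-vertex with two neighbours of degree 2; discharging then gives average
    degree at least 8/3. On the other hand a planar graph of girth 8 with [n]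
    vertices and [m] edges satisfies [3 m <= 4 (n - 1)]. To see this from a
    topological drawing, superimpose a fine square grid: rounding the arcs shows
    that the graph is a minor of the grid. Over the field with two elements every
    cycle of the grid is a sum of boundaries of unit squares, so the cycle space
    of the graph, of dimension at least [m - n + 1], is spanned by the boundaries
    of the regions left by the unused grid edges. Each edge lies on at most two
    of these boundaries, and each nonzero one has at least 8 edges.

    Lower bound. Replace every edge [xy] of [K_4] by two paths of length 4 whose
    numbers of forward arcs have different parities; pushing preserves this. In
    an oriented graph with at most three vertices a closed walk of length 4 has
    an even number of forward arcs, so [x] and [y] get different images. *)

(** * Sparse graphs *)

(** The tournament in which [(true, true)] dominates the directed triangle [(false, false)],
    [(false, true)], [(true, false)]. *)
Definition target_arc (u v : bool * bool) : bool :=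
  match u, v with
  | (true, true), (false, _) | (true, true), (true, false) => true
  | (false, false), (false, true) | (false, true), (true, false)
  | (true, false), (false, false) => true
  | _, _ => false
  end.

Notation color := (bool * bool * bool)%type.

(** The anti-twinned double: the last component of a colour says whether the vertex is pushed, and
    arcs between the two layers are reversed. *)
Definition antitwin_arc (c d : color) : bool :=
  if c.2 (+) d.2 then target_arc d.1 c.1 else target_arc c.1 d.1.

Definition dir_arc (b : bool) (c d : color) : bool :=
  if b then antitwin_arc c d else antitwin_arc d c.

Lemma target_arc_oriented : oriented target_arc.
Proof. by split=> [[[] []]|[[] []] [[] []]]. Qed.

Lemma dir_arc_sym b c d : dir_arc (~~ b) d c = dir_arc b c d.
Proof. by case: b. Qed.

Definition bools := [:: true; false].
Definition colors : seq color :=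
  [seq (x, z) | x <- [seq (x, y) | x <- bools, y <- bools], z <- bools].

Lemma mem_bools b : b \in bools. Proof. by case: b. Qed.
Lemma mem_colors c : c \in colors. Proof. by case: c => [[[] []] []]. Qed.

Lemma extend_deg1 b c : exists d, dir_arc b c d.
Proof.
have /allP/(_ b (mem_bools b))/allP/(_ c (mem_colors c))/hasP[d _ H] :
  all (fun b => all (fun c => has (dir_arc b c) colors) colors) bools by [].
by exists d.
Qed.

Lemma extend_path3 b1 b2 b3 c c' :
  exists d d', [/\ dir_arc b1 c d, dir_arc b2 d d' & dir_arc b3 d' c'].
Proof.
have : all (fun b1 => all (fun b2 => all (fun b3 => all (fun c => all (fun c' =>
   has (fun d => dir_arc b1 c d && has (fun d' => dir_arc b2 d d' && dir_arc b3 d' c')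
     colors) colors) colors) colors) bools) bools) bools by vm_compute.
move=> /allP/(_ b1 (mem_bools _))/allP/(_ b2 (mem_bools _))/allP/(_ b3 (mem_bools _)).
move=> /allP/(_ c (mem_colors _))/allP/(_ c' (mem_colors _))/hasP[d _ /andP[H1]].
by case/hasP=> d' _ /andP[H2 H3]; exists d, d'.
Qed.

(** The excluded colour is [c] itself when the two edges form a directed path, and the anti-twin of
    [c] otherwise. *)
Lemma extend_path2 b b' c : exists k, forall d, d != k ->
  exists d', dir_arc b d d' && dir_arc b' d' c.
Proof.
have : all (fun b => all (fun b' => all (fun c => has (fun k => all (fun d =>
   (d != k) ==> has (fun d' => dir_arc b d d' && dir_arc b' d' c) colors)
     colors) colors) colors) bools) bools by vm_compute.
move=> /allP/(_ b (mem_bools _))/allP/(_ b' (mem_bools _))/allP/(_ c (mem_colors _)).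
case/hasP=> k _ /allP H; exists k => d dk.
by have := H d (mem_colors _); rewrite dk => /hasP[d' _ Hd]; exists d'.
Qed.

(** Every colour has three out-neighbours and three in-neighbours, so two forbidden colours always
    leave one. *)
Lemma extend_avoid b c k1 k2 : exists d, [/\ dir_arc b c d, d != k1 & d != k2].
Proof.
have : all (fun b => all (fun c => all (fun k1 => all (fun k2 => has (fun d =>
   [&& dir_arc b c d, d != k1 & d != k2]) colors) colors) colors) colors) bools
  by vm_compute.
move=> /allP/(_ b (mem_bools _))/allP/(_ c (mem_colors _)).
move=> /allP/(_ k1 (mem_colors _))/allP/(_ k2 (mem_colors _)).
by case/hasP=> d _ /and3P[]; exists d.
Qed.

(** * Reducible configurations and discharging *)

Section Coloring.
Variables (T : finType) (e o : rel T).
Hypothesis e_sym : symmetric e.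
Hypothesis e_irr : irreflexive e.
Hypothesis ori : orientation_of e o.
Implicit Types X Y : {set T}.

Definition nbrs (X : {set T}) x := [set y in X | e x y].

Lemma in_nbrs X x y : (y \in nbrs X x) = (y \in X) && e x y.
Proof. by rewrite inE. Qed.

Lemma edge_nbrs X x y : y \in X -> e x y -> y \in nbrs X x.
Proof. by rewrite in_nbrs => -> ->. Qed.

Lemma edge_neq x y : e x y -> x != y.
Proof. by apply: contraTneq => ->; rewrite e_irr. Qed.

Lemma ori_sym x y : e x y -> o y x = ~~ o x y.
Proof. by move=> /(proj2 (ori x y)); case: (o x y); case: (o y x). Qed.

Definition arc_ok (f : T -> color) x y := dir_arc (o x y) (f x) (f y).

Definition good_on (X : {set T}) (f : T -> color) :=
  forall x y, x \in X -> y \in X -> e x y -> arc_ok f x y.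

Lemma arc_ok_sym f x y : e x y -> arc_ok f y x = arc_ok f x y.
Proof. by move=> exy; rewrite /arc_ok (ori_sym exy) dir_arc_sym. Qed.

Lemma nbrs2P X x y : #|nbrs X x| = 2 -> y \in nbrs X x ->
  exists2 z, z != y & nbrs X x = [set y; z].
Proof.
move=> d2 yx; have := cardsD1 y (nbrs X x); rewrite yx d2 => -[/esym/eqP].
move=> /cards1P[z Ez]; exists z; last by rewrite -Ez setD1K.
by have : z \in nbrs X x :\ y; [rewrite Ez set11 | rewrite in_setD1 => /andP[]].
Qed.

Lemma nbrs3P X x y z : #|nbrs X x| = 3 -> y \in nbrs X x -> z \in nbrs X x -> y != z ->
  exists w, [/\ w != y, w != z & nbrs X x = [set y; z; w]].
Proof.
move=> d3 yx zx yz; have := cardsD1 y (nbrs X x); rewrite yx d3 add1n => -[d2].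
have zx' : z \in nbrs X x :\ y by rewrite in_setD1 zx eq_sym yz.
have := cardsD1 z (nbrs X x :\ y); rewrite zx' -d2 add1n => -[/esym/eqP/cards1P[w Ew]].
have : w \in nbrs X x :\ y :\ z by rewrite Ew set11.
rewrite !in_setD1 => /and3P[wz wy _]; exists w; split=> //.
by rewrite -(setD1K yx) -(setD1K zx') Ew setUA.
Qed.

(** Only edges at newly coloured vertices need a check, and one direction is enough because [arc_ok]
    is symmetric on edges. *)
Lemma good_on_extend (X Y : {set T}) f h : good_on Y f ->
  (forall x, x \in Y -> h x = f x) ->
  (forall x y, x \in X -> x \notin Y -> y \in nbrs X x -> arc_ok h x y) ->
  good_on X h.
Proof.
move=> gf hf H x y xX yX exy.
have [xY|xY] := boolP (x \in Y); last by apply: H => //; apply: edge_nbrs.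
have [yY|yY] := boolP (y \in Y).
  by rewrite /arc_ok !hf //; apply: gf.
by rewrite -(arc_ok_sym _ exy); apply: H => //; apply: edge_nbrs; rewrite 1?e_sym.
Qed.

Lemma good_on_deg1 X x : x \in X -> #|nbrs X x| <= 1 ->
  (exists f, good_on (X :\ x) f) -> exists f, good_on X f.
Proof.
move=> xX d1 [f gf].
have [c Hc] : exists c, forall y, y \in nbrs X x -> dir_arc (o x y) c (f y).
  case: (set_0Vmem (nbrs X x)) => [N0|[y yN]].
    by exists (f x) => y; rewrite N0 inE.
  have [c Hc] := extend_deg1 (o y x) (f y); exists c => z zN.
  have -> : z = y by apply: (card_le1_eqP d1).
  move: yN; rewrite in_nbrs e_sym => /andP[_ eyx].
  by rewrite (ori_sym eyx) dir_arc_sym.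
exists (fun z => if z == x then c else f z); apply: (good_on_extend gf) => [z|z y zX].
  by rewrite in_setD1 => /andP[/negbTE->].
rewrite in_setD1 zX andbT negbK => /eqP-> yN; rewrite /arc_ok eqxx.
have /negbTE-> : y != x; last exact: Hc.
by rewrite eq_sym edge_neq //; move: yN; rewrite in_nbrs => /andP[].
Qed.

(** The two vertices are the inner vertices of a walk of length 3, whose ends impose no restriction
    by [extend_path3]; the ends may coincide. *)
Lemma good_on_adjacent2 X x y : x \in X -> y \in X -> e x y ->
  #|nbrs X x| = 2 -> #|nbrs X y| = 2 ->
  (exists f, good_on (X :\ x :\ y) f) -> exists f, good_on X f.
Proof.
move=> xX yX exy dx dy [f gf]; have nxy := edge_neq exy.
have [|x' nx' Nx] := nbrs2P (y := y) dx; first exact: edge_nbrs.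
have [|y' ny' Ny] := nbrs2P (y := x) dy; first by apply: edge_nbrs; rewrite 1?e_sym.
have exx' : e x x'.
  by have : x' \in nbrs X x; [rewrite Nx !inE eqxx orbT | rewrite in_nbrs => /andP[]].
have eyy' : e y y'.
  by have : y' \in nbrs X y; [rewrite Ny !inE eqxx orbT | rewrite in_nbrs => /andP[]].
have [cx [cy [H1 H2 H3]]] := extend_path3 (o x' x) (o x y) (o y y') (f x') (f y').
pose h z := if z == x then cx else if z == y then cy else f z.
have hx : h x = cx by rewrite /h eqxx.
have hy : h y = cy by rewrite /h eqxx eq_sym (negbTE nxy).
have hx' : h x' = f x' by rewrite /h eq_sym (negbTE (edge_neq exx')) (negbTE nx').
have hy' : h y' = f y'.
  by rewrite /h (negbTE ny') eq_sym (negbTE (edge_neq eyy')).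
have okx' : arc_ok h x x' by rewrite -(arc_ok_sym _ exx') /arc_ok hx hx'.
have oky' : arc_ok h y y' by rewrite /arc_ok hy hy'.
have okxy : arc_ok h x y by rewrite /arc_ok hx hy.
exists h; apply: (good_on_extend gf) => [z|z w zX].
  by rewrite !in_setD1 /h => /and3P[/negbTE-> /negbTE->].
rewrite !in_setD1 zX andbT negb_and !negbK.
move=> /orP[]/eqP->; rewrite ?Nx ?Ny !inE => /orP[]/eqP-> //.
by rewrite arc_ok_sym.
Qed.

(** The colour of [v] is chosen to fit its third neighbour [w] and to avoid the two colours excluded
    by the paths of length 2 through [a] and [b]; colours for [a] and [b] then exist. *)
Lemma good_on_deg3 X v a b : v \in X -> #|nbrs X v| = 3 -> a != b ->
  a \in nbrs X v -> b \in nbrs X v -> ~~ e a b -> #|nbrs X a| = 2 -> #|nbrs X b| = 2 ->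
  (exists f, good_on (X :\ v :\ a :\ b) f) -> exists f, good_on X f.
Proof.
move=> vX d3 nab aN bN neab da db [f gf].
have [w [wa wb Nv]] := nbrs3P d3 aN bN nab.
have [aX eva] : a \in X /\ e v a by move: aN; rewrite in_nbrs => /andP[].
have [bX evb] : b \in X /\ e v b by move: bN; rewrite in_nbrs => /andP[].
have evw : e v w.
  by have : w \in nbrs X v; [rewrite Nv !inE eqxx orbT | rewrite in_nbrs => /andP[]].
have [|a' na' Na] := nbrs2P (y := v) da; first by rewrite in_nbrs vX e_sym.
have [|b' nb' Nb] := nbrs2P (y := v) db; first by rewrite in_nbrs vX e_sym.
have eaa' : e a a'.
  by have : a' \in nbrs X a; [rewrite Na !inE eqxx orbT | rewrite in_nbrs => /andP[]].
have ebb' : e b b'.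
  by have : b' \in nbrs X b; [rewrite Nb !inE eqxx orbT | rewrite in_nbrs => /andP[]].
have [ka Ha] := extend_path2 (o v a) (o a a') (f a').
have [kb Hb] := extend_path2 (o v b) (o b b') (f b').
have [c [Hc /Ha[ca /andP[Hva Haa']] /Hb[cb /andP[Hvb Hbb']]]] :=
  extend_avoid (o w v) (f w) ka kb.
pose h z := if z == v then c else if z == a then ca else if z == b then cb else f z.
have nva := edge_neq eva; have nvb := edge_neq evb; have nvw := edge_neq evw.
have na'a := edge_neq eaa'; have nb'b := edge_neq ebb'.
(* Since [a] and [b] are not adjacent, their outer neighbours [a'] and [b'] keep the colours given
   by [f]. *)
have nba' : b != a' by apply: contraNneq neab => ->.
have nab' : a != b' by apply: contraNneq neab => ->; rewrite e_sym.
have hv : h v = c by rewrite /h eqxx.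
have ha : h a = ca by rewrite /h eqxx eq_sym (negbTE nva).
have hb : h b = cb by rewrite /h eqxx eq_sym (negbTE nvb) eq_sym (negbTE nab).
have hw : h w = f w by rewrite /h eq_sym (negbTE nvw) (negbTE wa) (negbTE wb).
have ha' : h a' = f a'.
  by rewrite /h (negbTE na') !(eq_sym a') (negbTE na'a) (negbTE nba').
have hb' : h b' = f b'.
  by rewrite /h (negbTE nb') !(eq_sym b') (negbTE nb'b) (negbTE nab').
have okw : arc_ok h v w by rewrite -(arc_ok_sym _ evw) /arc_ok hv hw.
have oka : arc_ok h v a by rewrite /arc_ok hv ha.
have okb : arc_ok h v b by rewrite /arc_ok hv hb.
have oka' : arc_ok h a a' by rewrite /arc_ok ha ha'.
have okb' : arc_ok h b b' by rewrite /arc_ok hb hb'.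
exists h; apply: (good_on_extend gf) => [z|z y zX].
  by rewrite !in_setD1 /h => /and4P[/negbTE-> /negbTE-> /negbTE-> _].
rewrite !in_setD1 zX andbT !negb_and !negbK => /or3P[]/eqP->.
- by rewrite Nb !inE => /orP[]/eqP-> //; rewrite arc_ok_sym.
- by rewrite Na !inE => /orP[]/eqP-> //; rewrite arc_ok_sym.
- by rewrite Nv !inE => /orP[/orP[]|]/eqP->.
Qed.

Definition reducible (X : {set T}) := [\/
  exists2 x, x \in X & #|nbrs X x| <= 1,
  exists x y, [/\ x \in X, y \in X, e x y, #|nbrs X x| = 2 & #|nbrs X y| = 2] |
  exists v a b, [/\ v \in X, #|nbrs X v| = 3, a != b, a \in nbrs X v & b \in nbrs X v]
     /\ [/\ ~~ e a b, #|nbrs X a| = 2 & #|nbrs X b| = 2]].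

(* Discharging: every 2-vertex receives 1/3 from each of its two neighbours. *)
Lemma sparse_reducible (X : {set T}) :
  3 * (\sum_(x in X) #|nbrs X x|) < 8 * #|X| -> reducible X.
Proof.
move=> sp; apply: contrapT => nred.
have deg2 x : x \in X -> 1 < #|nbrs X x|.
  by move=> xX; rewrite ltnNge; apply/negP => d1; apply: nred; constructor 1; exists x.
have adj2 x y : x \in X -> y \in X -> #|nbrs X x| = 2 -> #|nbrs X y| = 2 -> ~~ e x y.
  by move=> xX yX dx dy; apply/negP => exy; apply: nred; constructor 2; exists x, y.
pose two y := #|nbrs X y| == 2.
pose N2 x := [set y in nbrs X x | two y].
have N2le x : #|N2 x| <= #|nbrs X x|.
  by apply: subset_leq_card; apply/subsetP => y; rewrite inE => /andP[].
(* Charges are multiplied by 3: a vertex gives 1 to each 2-neighbour and a 2-vertex gains 2, so this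
   says that the final degree is at least 8/3. *)
have bound x : x \in X -> 8 + #|N2 x| <= 3 * #|nbrs X x| + (two x).*2.
  move=> xX; have d2 := deg2 x xX; have l := N2le x; rewrite /two.
  case: eqP => [E|ne2] /=.
    suff -> : N2 x = set0 by rewrite cards0 E.
    apply/setP => y; rewrite !inE; apply/negP => /andP[/andP[yX exy] /eqP dy].
    by move/negP: (adj2 x y xX yX E dy); apply.
  (* A degree [d >= 4] satisfies [3 d - 8 >= d] and can pay every neighbour; a 3-vertex can pay only
     one. *)
  have [d3|n3] := eqVneq #|nbrs X x| 3; last by lia.
  suff : #|N2 x| <= 1 by lia.
  apply/card_le1_eqP => a b; rewrite !inE.
  move=> /andP[/andP[aX exa] /eqP da] /andP[/andP[bX exb] /eqP db].
  apply/eqP/negPn/negP => nab; apply: nred; constructor 3.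
  exists x, a, b; split; split => //; rewrite ?in_nbrs ?aX ?bX // 1?eq_sym //.
  exact: adj2.
(* Total charge is preserved: pairs of a vertex and a 2-neighbour are counted from both sides. *)
have dc : \sum_(x in X) #|N2 x| = \sum_(y in X) (two y).*2.
  transitivity (\sum_(x in X) \sum_(y in X | e x y && two y) 1).
    apply: eq_bigr => x _; rewrite sum1dep_card; apply: eq_card => y.
    by rewrite !inE -andbA.
  rewrite (exchange_big_dep (mem X)) /=; last by move=> x y _ /andP[].
  apply: eq_bigr => y yX; rewrite /two; case: eqP => [E|ne2] /=; last first.
    by rewrite big1 // => x /and3P[_]; rewrite andbF.
  rewrite -[RHS]E sum1dep_card; apply: eq_card => x.
  by rewrite !inE yX /= andbT e_sym.
have : \sum_(x in X) (8 + #|N2 x|) <= \sum_(x in X) (3 * #|nbrs X x| + (two x).*2).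
  exact: leq_sum.
rewrite big_split [X in _ <= X]big_split /= sum_nat_const dc => le.
by move: sp; rewrite big_distrr /=; lia.
Qed.

Lemma sparse_good_on : (forall X : {set T}, X != set0 ->
    3 * (\sum_(x in X) #|nbrs X x|) < 8 * #|X|) ->
  forall X : {set T}, exists f, good_on X f.
Proof.
move=> sp X; have [n] := ubnP #|X|; elim: n X => // n IH X ltX.
have [->|X0] := eqVneq X set0.
  by exists (fun=> (true, true, true)) => x y; rewrite inE.
have IHX (Y : {set T}) x : x \in X -> Y \subset X :\ x -> exists f, good_on Y f.
  move=> xX /subset_leq_card YX; apply: IH.
  by move: ltX YX; rewrite (cardsD1 x X) xX; lia.
case: (sparse_reducible (sp X X0)) =>
  [[x xX d1]|[x [y [xX yX exy dx dy]]]|[v [a [b [[vX dv nab aN bN] [neab da db]]]]]].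
- by apply: (good_on_deg1 xX d1); apply: (IHX _ x).
- by apply: (good_on_adjacent2 xX yX exy dx dy); apply: (IHX _ x) => //; apply: subsetDl.
- apply: (good_on_deg3 vX dv nab aN bN neab da db); apply: (IHX _ v) => //.
  by apply: subset_trans (subsetDl _ _) (subsetDl _ _).
Qed.

Lemma sparse_push_colorable : (forall X : {set T}, X != set0 ->
    3 * (\sum_(x in X) #|nbrs X x|) < 8 * #|X|) -> push_colorable o 4.
Proof.
move=> /sparse_good_on/(_ setT)[f gf].
exists (bool * bool)%type, target_arc; split; first by rewrite card_prod card_bool.
split; first exact: target_arc_oriented.
(* Pushing the vertices coloured in the second layer turns a homomorphism to the double into one to
   the tournament. *)
exists [set x | (f x).2], (fst \o f) => x y; rewrite /push !inE /=.
have arc u v : o u v -> antitwin_arc (f u) (f v).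
  by move=> ouv; have := gf u v (in_setT _) (in_setT _) (proj1 (ori u v) ouv);
     rewrite /arc_ok ouv.
by case: ifP => xy /arc; rewrite /antitwin_arc; [rewrite addbC xy | rewrite xy].
Qed.

End Coloring.

(** * Minors of the square grid *)

Section Torus.
Local Open Scope ring_scope.
Variable n : nat.

(* The grid is cyclic so that translations are bijections; nothing wraps around,
   because branch sets avoid the row and the column of index 0. *)
Definition torus := ('I_n.+2 * 'I_n.+2)%type.
Definition torus_edge := (bool * torus)%type.

Definition dir (b : bool) : torus := if b then (1, 0) else (0, 1).
Definition end1 (a : torus_edge) : torus := a.2.
Definition end2 (a : torus_edge) : torus := a.2 + dir a.1.

Definition tadj (q q' : torus) : bool :=
  [exists a, ((end1 a == q) && (end2 a == q')) || ((end1 a == q') && (end2 a == q))].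

(* Chains take values in the field [bool] with two elements. *)
Definition deg (x : torus_edge -> bool) (q : torus) : bool :=
  (x (true, q) + x (true, q - dir true)) + (x (false, q) + x (false, q - dir false)).

(* The square [q] has corners [q] and [q + (1, 1)]. *)
Definition side1 (a : torus_edge) : torus := a.2.
Definition side2 (a : torus_edge) : torus := a.2 - dir (~~ a.1).
Definition cobord (f : torus -> bool) (a : torus_edge) : bool := f (side1 a) + f (side2 a).

Lemma addbb2 (b : bool) : b + b = 0. Proof. by case: b. Qed.

Lemma addb_eq0 (b c : bool) : (b + c == 0) = (b == c).
Proof. by case: b; case: c. Qed.

(** Each of the four squares around [q] has exactly two sides at [q], so every value of [f] appears
    twice. *)
Lemma deg_cobord f q : deg (cobord f) q = 0.
Proof.
rewrite /deg /cobord /side1 /side2 /= [q - (0, 1) - (1, 0)]addrAC.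
by case: (f _); case: (f _); case: (f _); case: (f _).
Qed.

Lemma degD x y q : deg (fun a => x a + y a) q = deg x q + deg y q.
Proof.
rewrite /deg; do 4!case: (x _); do 4!case: (y _) => //.
Qed.

Lemma deg_scale (t : bool) x q : deg (fun a => t * x a) q = t * deg x q.
Proof. by case: t. Qed.

Lemma deg_sum (I : Type) (r : seq I) (Q : pred I) (y : I -> torus_edge -> bool) q :
  deg (fun a => \sum_(i <- r | Q i) y i a) q = \sum_(i <- r | Q i) deg (y i) q.
Proof. by rewrite /deg !big_split. Qed.

(** A handshake formula modulo 2: only edges with exactly one end in [X] contribute. *)
Lemma deg_sum_set x (X : {set torus}) :
  \sum_(q in X) deg x q = \sum_a x a * ((end1 a \in X) + (end2 a \in X)).
Proof.
have shift b : \sum_(q in X) x (b, q - dir b) = \sum_q x (b, q) * (q + dir b \in X).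
  rewrite big_mkcond (reindex_inj (addIr (dir b))) /=; apply: eq_bigr => q _.
  by rewrite addrK; case: ifP; rewrite ?mulr1 ?mulr0.
have stay b : \sum_(q in X) x (b, q) = \sum_q x (b, q) * (q \in X).
  by rewrite big_mkcond /=; apply: eq_bigr => q _; case: ifP; rewrite ?mulr1 ?mulr0.
rewrite /deg !big_split /= !shift !stay -!big_split /=.
rewrite (eq_bigr (fun a => x (a.1, a.2) * ((a.2 \in X) + (a.2 + dir a.1 \in X)))); last by case.
rewrite -(pair_bigA _ (fun b q => x (b, q) * ((q \in X) + (q + dir b \in X)))) /=.
rewrite big_bool /= -big_split /=.
by apply: eq_bigr => q _; rewrite -!mulrDr.
Qed.

Lemma deg_delta (a : torus_edge) q : deg (fun a' => a' == a) q = (end1 a == q) + (end2 a == q).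
Proof.
case: a => b p; rewrite /deg /end1 /end2 /= !xpair_eqE.
have E (u : torus) : (q - u == p) = (p + u == q) by rewrite subr_eq eq_sym.
by case: b; rewrite /= !E (eq_sym q) ?addr0 ?add0r.
Qed.

Lemma val_subr1 (j : 'I_n.+2) m : val j = m.+1 -> val (j - 1) = m.
Proof.
move=> jm; suff -> : j - 1 = inord m by rewrite /= inordK // ltnW // -jm ltn_ord.
have ltm : (m.+1 < n.+2)%N by rewrite -jm ltn_ord.
apply/eqP; rewrite subr_eq; apply/eqP/val_inj.
by rewrite /= inordK 1?ltnW // -[nat_of_ord j]/(val j) jm !modn_small ?addn1.
Qed.

Lemma end2_sub b q : end2 (b, q - dir b) = q.
Proof. by rewrite /end2 subrK. Qed.

Lemma ord_neq0 (j : 'I_n.+2) : j != 0 -> exists m, val j = m.+1.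
Proof. by rewrite -val_eqE; case: j => [[|m] ltj] //= _; exists m. Qed.

(* Discrete Poincare lemma: [f q] counts [x] along the vertical ray below the square [q]. *)
Lemma cobord_exists x : (forall q, deg x q = 0) ->
  (forall a, (0 \in [:: (end1 a).1; (end1 a).2; (end2 a).1; (end2 a).2]) -> x a = 0) ->
  exists f, forall a, x a = cobord f a.
Proof.
move=> dx x0; pose f (q : torus) : bool := \sum_(k < n.+2 | k <= q.2) x (true, (q.1, k)).
have f0 (q : torus) : q.2 = 0 -> f q = x (true, q).
  case: q => i j /= ->; rewrite /f /= (big_pred1 (0 : 'I_n.+2)) // => k.
  by rewrite /= leqn0 -val_eqE.
have fS (q : torus) : q.2 != 0 -> f q = x (true, q) + f (q - dir false).
  case: q => i j /= j0; rewrite /f /= subr0 (bigD1 j) //=; congr (_ + _).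
  have [m jm] := ord_neq0 j0; have jm' := val_subr1 jm.
  apply: eq_bigl => k; rewrite -val_eqE /=; move: jm jm' => /=; lia.
(* Crossing a vertical edge: induction on the row, using the vanishing degree at [q]. *)
have fv (q : torus) : f q + f (q - dir true) = x (false, q).
  have [m] := ubnP (val q.2); elim: m q => // m IH q ltq.
  have xd := dx q; rewrite /deg in xd.
  have [q0|q0] := eqVneq q.2 0.
    rewrite !f0 //=; last by rewrite q0 subr0.
    have xz : x (false, q - dir false) = 0.
      by apply: x0; rewrite end2_sub q0 !inE eqxx !orbT.
    move: xd; rewrite xz; by case: (x (true, q)); case: (x _); case: (x _).
  have [k qv] := ord_neq0 q0.
  rewrite (fS q q0) (fS (q - dir true)); last by rewrite /= subr0.
  have := IH (q - dir false); rewrite [(q - dir false).2]/= (val_subr1 qv) => E.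
  have {}E := E ltac:(rewrite qv in ltq; exact: ltq).
  rewrite [q - dir true - _]addrAC.
  move: xd; rewrite -E.
  by case: (x _); case: (x _); case: (x _); case: (f _); case: (f _).
(* The square below row 0 wraps around to row [-1], so the full column sums must vanish; this
   follows column by column from [fv], as [x] is 0 on edges that wrap around. *)
have top i : f (i, -1) = 0.
  have [m] := ubnP (val i); elim: m i => // m IH i lti.
  have [i0|i0] := eqVneq i 0.
    by rewrite /f big1 // => k _; apply: x0; rewrite /end1 /= i0 !inE eqxx.
  have [k iv] := ord_neq0 i0.
  have := fv (i, -1); rewrite [(i, -1) - dir true]/= x0; last first.
    by rewrite /end2 /end1 /= !inE addNr eqxx !orbT.
  have -> : (i, -1) - dir true = (i - 1, -1) by congr (_, _); rewrite subr0.
  rewrite (IH (i - 1)) ?addr0 //.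
  by rewrite (val_subr1 iv); rewrite iv in lti.
exists f => -[[] q]; rewrite /cobord /side1 /side2 /=; last by rewrite -fv.
have [q0|q0] := eqVneq q.2 0; last by rewrite (fS q q0) -addrA addbb2 addr0.
rewrite (f0 q q0).
have -> : q - (0, 1) = (q.1, -1).
  by case: q q0 => i j /= ->; rewrite -[LHS]/(i - 0, 0 - 1); congr (_, _); rewrite ?subr0 ?sub0r.
by rewrite top addr0.
Qed.
End Torus.

(** * The cycle space of a minor of the grid *)

Section GridMinor.
Local Open Scope ring_scope.
Variable n : nat.
Variables (V E : finType) (src tgt : E -> V).
Hypothesis no_loop : forall i, src i != tgt i.
Variables (fib : V -> {set torus n}) (ctr : V -> torus n) (rho : E -> torus_edge n).
Hypothesis fib_off0 : forall v q, q \in fib v -> (q.1 != 0) && (q.2 != 0).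
Hypothesis fib_disj : forall u v q, q \in fib u -> q \in fib v -> u = v.
Hypothesis fib_conn : forall v q, q \in fib v ->
  connect [rel a b | [&& tadj a b, a \in fib v & b \in fib v]] (ctr v) q.
Hypothesis rho_inj : injective rho.
Hypothesis rho_ends : forall i,
  (end1 (rho i) \in fib (src i)) && (end2 (rho i) \in fib (tgt i)) ||
  (end1 (rho i) \in fib (tgt i)) && (end2 (rho i) \in fib (src i)).

Definition internal v a := (end1 a \in fib v) && (end2 a \in fib v).
Definition used a := [exists v, internal v a] || (a \in codom rho).
Definition bd (z : E -> bool) v : bool := \sum_i z i * ((src i == v) + (tgt i == v)).

Lemma in_fib u v q : q \in fib u -> (q \in fib v) = (u == v).
Proof. by move=> qu; apply/idP/eqP => [/(fib_disj qu)|<-]. Qed.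

Lemma rho_cross i v :
  (end1 (rho i) \in fib v) + (end2 (rho i) \in fib v) = (src i == v) + (tgt i == v).
Proof.
by case/orP: (rho_ends i) => /andP[/in_fib-> /in_fib->] //; rewrite addrC.
Qed.

Lemma rho_not_internal i v : ~~ internal v (rho i).
Proof.
apply/negP => /andP[h1 h2].
have /negP := no_loop i; apply; apply/eqP.
by case/orP: (rho_ends i) => /andP[/(fib_disj h1) <- /(fib_disj h2) <-].
Qed.

Lemma used_off0 a :
  0 \in [:: (end1 a).1; (end1 a).2; (end2 a).1; (end2 a).2] -> ~~ used a.
Proof.
move=> a0; apply/negP => ua.
have [u [v [/fib_off0/andP[p1 p2] /fib_off0/andP[p3 p4]]]] :
    exists u v, end1 a \in fib u /\ end2 a \in fib v.
  case/orP: ua => [/existsP[v /andP[]]|/codomP[i ->]]; first by exists v, v.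
  by case/orP: (rho_ends i) => /andP[]; [exists (src i), (tgt i) | exists (tgt i), (src i)].
by move: a0; rewrite !inE !(eq_sym 0) (negbTE p1) (negbTE p2) (negbTE p3) (negbTE p4).
Qed.

(** Contracting the branch sets commutes with taking boundaries: an internal edge has both ends in
    one branch set and cancels. *)
Lemma deg_sum_fib x v : (forall a, ~~ used a -> x a = 0) ->
  \sum_(q in fib v) deg x q = bd (x \o rho) v.
Proof.
move=> xU; rewrite deg_sum_set (bigID (mem (rho @: E))) /= addrC big1 ?add0r.
  rewrite big_imset /=; last by move=> i j _ _ /rho_inj.
  by apply: eq_bigr => i _; rewrite rho_cross.
move=> a aR; have [ua|/xU->] := boolP (used a); last by rewrite mul0r.
have /existsP[u /andP[/in_fib-> /in_fib->]] : [exists u, internal u a].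
  by case/orP: ua => // /codomP[i ai]; rewrite ai imset_f in aR.
by rewrite addbb2 mulr0.
Qed.

Lemma edge_join u q q' v : tadj q q' -> q \in fib v -> q' \in fib v -> u = v ->
  exists y, (forall a, ~~ internal u a -> y a = 0) /\
    forall p, deg y p = (q == p) + (q' == p).
Proof.
move=> /existsP[a Ha] qv q'v ->; exists (fun a' => a' == a); split.
  move=> a' na'; apply/negbTE; apply: contraNneq na' => ->.
  by case/orP: Ha => /andP[/eqP E1 /eqP E2]; rewrite /internal E1 E2 qv q'v.
by move=> p; rewrite deg_delta; case/orP: Ha => /andP[/eqP-> /eqP->] //; rewrite addrC.
Qed.

Lemma path_join v q : q \in fib v ->
  exists y, (forall a, ~~ internal v a -> y a = 0) /\
    forall p, deg y p = (ctr v == p) + (q == p).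
Proof.
move=> /fib_conn/connectP[s]; elim: s (ctr v) => [|q1 s IH] q0 /= => [_ ->|].
  by exists (fun=> 0); split=> // p; rewrite addbb2.
move=> /andP[/and3P[a01 f0 f1] /IH{}IH /IH[y [yi yd]]].
have [y' [yi' yd']] := edge_join a01 f0 f1 erefl.
exists (fun a => y' a + y a); split=> [a na|p]; first by rewrite yi' // yi // addr0.
by rewrite degD yd yd'; case: (q0 == p); case: (q1 == p); case: (q == p).
Qed.

(** An even set of vertices in a connected branch set is the boundary of a chain inside it: join
    each of them to the centre, which is then hit an even number of times. *)
Lemma fib_join v (t : torus n -> bool) : \sum_(q in fib v) t q = 0 ->
  exists y, (forall a, ~~ internal v a -> y a = 0) /\
    forall p, deg y p = (p \in fib v) && t p.
Proof.
move=> t0.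
have /choice[y Hy] : forall q, exists y, q \in fib v ->
    (forall a, ~~ internal v a -> y a = 0) /\
    forall p, deg y p = (ctr v == p) + (q == p).
  move=> q; have [/path_join[y Hy]|] := boolP (q \in fib v); first by exists y.
  by exists (fun=> 0).
exists (fun a => \sum_(q in fib v) t q * y q a); split=> [a na|p].
  by rewrite big1 // => q qv; rewrite (proj1 (Hy q qv)) // mulr0.
rewrite deg_sum; under eq_bigr => q qv do rewrite deg_scale (proj2 (Hy q qv)) mulrDr.
rewrite big_split /= -mulr_suml t0 mul0r add0r.
have [pv|pv] := boolP (p \in fib v).
  rewrite (bigD1 p) //= eqxx mulr1 big1 ?addr0 // => q /andP[_ /negbTE->].
  by rewrite mulr0.
by rewrite big1 // => q qv; case: eqP => [qp|_]; [rewrite -qp qv in pv | case: (t q)].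
Qed.

(** A cycle of the minor is placed on the edges [rho i]; the odd vertices that arise are even in
    number in each branch set and are paired up inside it by [fib_join]. *)
Lemma lift_cycle z : (forall v, bd z v = 0) ->
  exists x, [/\ forall a, ~~ used a -> x a = 0, forall q, deg x q = 0
    & forall i, x (rho i) = z i].
Proof.
move=> bz; pose x0 a := [exists i, (rho i == a) && z i].
have x0rho i : x0 (rho i) = z i.
  by apply/existsP/idP => [[j /andP[/eqP/rho_inj->]]|zi] //; exists i; rewrite eqxx.
have x0U a : ~~ used a -> x0 a = 0.
  move=> ua; apply/negbTE; apply: contraNN ua => /existsP[i /andP[/eqP<- _]].
  by rewrite /used codom_f orbT.
have x0s v : \sum_(q in fib v) deg x0 q = 0.
  rewrite deg_sum_fib //; rewrite -[RHS](bz v); apply: eq_bigr => i _.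
  by rewrite /= x0rho.
have x0z q : (forall v, q \notin fib v) -> deg x0 q = 0.
  move=> nq; have := deg_sum_set x0 [set q]; rewrite big_set1 => ->.
  rewrite big1 // => a _; have [xa|//] := boolP (x0 a).
  case/existsP: xa => i /andP[/eqP<- _]; rewrite !in_set1.
  have [h1 h2] : end1 (rho i) != q /\ end2 (rho i) != q.
    by split; apply: contraPneq nq => <- nq; case/orP: (rho_ends i) => /andP[];
      rewrite !(negbTE (nq _)).
  by rewrite (negbTE h1) (negbTE h2).
have /choice[y Hy] := fun v => fib_join (x0s v).
exists (fun a => x0 a + \sum_v y v a); split=> [a ua|q|i].
- rewrite x0U // add0r big1 // => v _; apply: (proj1 (Hy v)).
  by apply: contraNN ua => ia; apply/orP; left; apply/existsP; exists v.
- rewrite degD deg_sum; under eq_bigr => v _ do rewrite (proj2 (Hy v)).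
  have [/existsP[v qv]|] := boolP [exists v, q \in fib v].
    rewrite (bigD1 v) //= qv big1 ?addr0 ?addbb2 // => u uv.
    by rewrite (in_fib u qv) eq_sym (negbTE uv).
  rewrite negb_exists => /forallP nq; rewrite x0z // add0r big1 // => v _.
  by rewrite (negbTE (nq v)).
- rewrite x0rho big1 ?addr0 // => v _.
  by rewrite (proj1 (Hy v)) // rho_not_internal.
Qed.

Definition across (s s' : torus n) : bool :=
  [exists a, ~~ used a && ((side1 a == s) && (side2 a == s')
                        || (side1 a == s') && (side2 a == s))].

Lemma across_sym : symmetric across.
Proof. by move=> s s'; apply: eq_existsb => a; rewrite orbC. Qed.

Definition region (s : torus n) : torus n := root across s.

Lemma region_across s s' : across s s' -> region s = region s'.
Proof.
by move=> ss'; apply/eqP; rewrite (root_connect (sym_connect_sym across_sym)) connect1.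
Qed.

Lemma region_unused a : ~~ used a -> region (side1 a) = region (side2 a).
Proof. by move=> ua; apply: region_across; apply/existsP; exists a; rewrite ua !eqxx. Qed.

Lemma region_const (f : torus n -> bool) : (forall a, ~~ used a -> cobord f a = 0) ->
  forall s, f (region s) = f s.
Proof.
move=> fU s; have /connectP[p ps ->] : connect across s (region s) := connect_root _ _.
elim: p s ps => //= s' p IH s /andP[/existsP[a /andP[/fU/eqP ua ss']] /IH->].
move: ua; rewrite /cobord addb_eq0 => /eqP.
by case/orP: ss' => /andP[/eqP-> /eqP->].
Qed.

Definition region_bd s i : bool :=
  cobord (fun s' => region s' == s) (rho i).

Lemma bd_region s v : bd (region_bd s) v = 0.
Proof.
rewrite -(deg_sum_fib (x := cobord (fun s' => region s' == s))).
  by rewrite big1 // => q _; rewrite deg_cobord.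
by move=> a ua; rewrite /cobord (region_unused ua) addbb2.
Qed.

Definition proper_regions : {set torus n} := [set s | [exists i, region_bd s i]].

Definition cycle_space : {set {ffun E -> bool}} :=
  [set z : {ffun E -> bool} | [forall v, bd z v == 0]].

Lemma card_cycle_space_le : (#|cycle_space| <= 2 ^ #|proper_regions|)%N.
Proof.
(* [psi H] is the sum of the boundaries of the regions in [H]. *)
pose psi (H : {set torus n}) : {ffun E -> bool} :=
  [ffun i => (region (side1 (rho i)) \in H) + (region (side2 (rho i)) \in H)].
suff sub : cycle_space \subset psi @: powerset proper_regions.
  by rewrite -card_powerset (leq_trans (subset_leq_card sub)) // leq_imset_card.
apply/subsetP => z; rewrite inE => /forallP bz.
have [x [xU xd xz]] := lift_cycle (fun v => eqP (bz v)).
have [f fx] := cobord_exists xd (fun a a0 => xU a (used_off0 a0)).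
have fc := region_const (fun a ua => etrans (esym (fx a)) (xU a ua)).
apply/imsetP; exists [set s in proper_regions | f s].
  by rewrite inE; apply/subsetP => s; rewrite inE => /andP[].
apply/ffunP => i; rewrite ffunE !inE -xz fx /cobord.
(* An edge with the same region on both sides contributes 0; otherwise both regions have [rho i] on
   their boundary and are proper. *)
have [Er|nE] := eqVneq (region (side1 (rho i))) (region (side2 (rho i))).
  by rewrite Er addbb2 -(fc (side1 _)) Er fc addbb2.
have -> : [exists j, region_bd (region (side1 (rho i))) j].
  by apply/existsP; exists i; rewrite /region_bd /cobord eqxx eq_sym (negbTE nE).
have -> : [exists j, region_bd (region (side2 (rho i))) j].
  by apply/existsP; exists i; rewrite /region_bd /cobord eqxx (negbTE nE).
by rewrite /= !fc.
Qed.

Lemma bdB (z z' : {ffun E -> bool}) v : bd (z - z') v = bd z v + bd z' v.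
Proof.
rewrite /bd -big_split /=; apply: eq_bigr => i _; rewrite !ffunE -mulrDl.
by congr (_ * _); case: (z i); case: (z' i).
Qed.

Lemma bd_total z : \sum_v bd z v = 0.
Proof.
rewrite /bd exchange_big big1 //= => i _; rewrite -mulr_sumr big_split /=.
have one w : \sum_v (w == v) = true :> bool.
  by rewrite (bigD1 w) //= eqxx big1 ?addr0 // => v; rewrite eq_sym => /negbTE.
by rewrite !one mulr0.
Qed.

(** Edge sets are classified by their boundary away from [v0]. Differences within a class are
    cycles, because the total boundary is 0 and this settles [v0]. *)
Lemma card_cycle_space_ge (v0 : V) : (2 ^ #|E| <= 2 ^ #|V|.-1 * #|cycle_space|)%N.
Proof.
pose B (z : {ffun E -> bool}) := [set v in [set~ v0] | bd z v].
have -> : (2 ^ #|E| = \sum_(z : {ffun E -> bool}) 1)%N.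
  by rewrite sum1_card card_ffun card_bool.
rewrite (partition_big B (mem (powerset [set~ v0]))) /=; last first.
  by move=> z _; rewrite inE; apply/subsetP => v; rewrite inE => /andP[].
have -> : (2 ^ #|V|.-1 = #|powerset [set~ v0]|)%N by rewrite card_powerset cardsC1.
rewrite -sum_nat_const; apply: leq_sum => D _; rewrite sum1dep_card.
case: (set_0Vmem [set z | B z == D]) => [->|[z0]]; first by rewrite cards0.
rewrite inE => /eqP Bz0; rewrite -(card_imset _ (subIr z0)).
apply: subset_leq_card; apply/subsetP => w /imsetP[z]; rewrite inE => /eqP Bz ->.
have off v : v != v0 -> bd (z - z0) v = 0.
  move=> vv0; have /setP/(_ v) := etrans Bz (esym Bz0); rewrite !inE vv0 /= bdB.
  by move=> ->; rewrite addbb2.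
rewrite inE; apply/forallP => v; have [->|/off->//] := eqVneq v v0.
by have := bd_total (z - z0); rewrite (bigD1 v0) //= big1 ?addr0 => [->|u /off].
Qed.

(** The two bounds on the cycle space give [#|E| <= #|V|.-1 + #|proper_regions|]. Each proper region
    has at least [g] boundary edges, and each edge bounds at most the two regions beside it. *)
Lemma grid_minor_edges (g : nat) (v0 : V) :
  (forall D : {set E}, D != set0 -> (forall v, bd (fun i => i \in D) v = 0) ->
     (g <= #|D|)%N) ->
  (g * #|E| <= g * #|V|.-1 + 2 * #|E|)%N.
Proof.
move=> girth.
have le1 : (#|E| <= #|V|.-1 + #|proper_regions|)%N.
  rewrite -(@leq_exp2l 2) // expnD (leq_trans (card_cycle_space_ge v0)) //.
  by rewrite leq_mul2l card_cycle_space_le orbT.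
suff le2 : (#|proper_regions| * g <= 2 * #|E|)%N by nia.
have -> : (2 * #|E| = \sum_(i : E) 2)%N by rewrite sum_nat_const mulnC.
rewrite -sum_nat_const.
apply: (@leq_trans (\sum_(s in proper_regions) \sum_(i | region_bd s i) 1)%N).
  apply: leq_sum => s; rewrite inE => /existsP[i si]; rewrite sum1dep_card.
  apply: girth; first by apply/set0Pn; exists i; rewrite inE.
  move=> v; rewrite -[RHS](bd_region s v); apply: eq_bigr => j _; by rewrite inE.
rewrite (exchange_big_dep predT) //=; apply: leq_sum => i _.
rewrite sum1dep_card.
apply: (@leq_trans #|[set region (side1 (rho i)); region (side2 (rho i))]|); last first.
  by rewrite cards2; case: eqP.
apply: subset_leq_card; apply/subsetP => s; rewrite !inE => /andP[_].
rewrite /region_bd /cobord !(eq_sym s).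
by case: (region _ == s); case: (region _ == s).
Qed.

End GridMinor.

(** * Edge counts under the girth condition *)

Lemma mindeg2_cycle (T : finType) (d : rel T) x y :
  symmetric d -> irreflexive d -> d x y ->
  (forall u v, d u v -> exists2 w, w != v & d u w) ->
  exists s, [/\ uniq s, cycle d s & 3 <= size s].
Proof.
move=> d_sym d_irr dxy deg2.
(* A path is prolonged at its first vertex without turning back; it must close up before exhausting
   [T]. *)
suff long k : (exists s, [/\ uniq s, cycle d s & 3 <= size s]) \/
    (exists u s, [/\ path d u s, uniq (u :: s) & size s = k.+1]).
  case: (long #|T|) => // -[u [s [_ /card_uniqP us sz]]].
  by have := max_card (mem (u :: s)); rewrite us /= sz => /ltnW; rewrite ltnn.
elim: k => [|k [|[u [[|v s] [//= /andP[duv pv] us [sz]]]]]]; [|by left|].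
  right; exists x, [:: y]; rewrite /= dxy inE; split=> //.
  by rewrite andbT; apply: contraTneq dxy => ->; rewrite d_irr.
have [w wv duw] := deg2 u v duv.
have [ws|nws] := boolP (w \in v :: s); last first.
  right; exists w, [:: u, v & s]; rewrite /= d_sym duw duv pv sz; split=> //.
  rewrite us andbT !inE !negb_or (_ : w != u) /=; last first.
    by apply: contraTneq duw => ->; rewrite d_irr.
  by move: nws; rewrite inE negb_or.
left; have win : w \in s by move: ws; rewrite inE (negbTE wv).
case/splitPr: win {ws sz} pv us => p1 p2 pv us.
exists [:: u, v & rcons p1 w]; split.
- have : uniq ([:: u, v & rcons p1 w] ++ p2) by rewrite /= cat_rcons.
  by rewrite cat_uniq => /andP[].
- move: pv; rewrite -cat_rcons cat_path => /andP[pv _].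
  by rewrite /cycle rcons_path /= duv pv last_rcons d_sym.
- by rewrite /= size_rcons.
Qed.

Lemma sum_bool_odd (I : finType) (b : I -> bool) :
  (\sum_i b i)%R = odd #|[set i | b i]|.
Proof.
have oddDr : {morph odd : m k / m + k >-> (m + k)%R} := oddD.
rewrite -sum1dep_card (big_morph odd oddDr (erefl : odd 0 = 0%R)) [RHS]big_mkcond.
by apply: eq_bigr => i _; case: (b i).
Qed.

Section EdgeCount.
Variables (T : finType) (e : rel T).
Hypothesis e_simple : simple_graph e.
Hypothesis e_girth : girth_at_least e 8.

(** The rank condition selects one ordered pair for each undirected edge. *)
Definition is_edge (p : T * T) := e p.1 p.2 && (enum_rank p.1 < enum_rank p.2).
Definition edge_type : finType := {p | is_edge p}.
Definition esrc (i : edge_type) : T := (val i).1.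
Definition etgt (i : edge_type) : T := (val i).2.

Lemma esrc_etgt (i : edge_type) : e (esrc i) (etgt i).
Proof. by case/andP: (valP i). Qed.

Lemma esrc_lt (i : edge_type) : enum_rank (esrc i) < enum_rank (etgt i).
Proof. by case/andP: (valP i). Qed.

Lemma esrc_neq (i : edge_type) : esrc i != etgt i.
Proof. by apply: contraTneq (esrc_etgt i) => ->; rewrite (proj2 e_simple). Qed.

Lemma edge_type_eq (i j : edge_type) : esrc i = esrc j -> etgt i = etgt j -> i = j.
Proof.
by rewrite /esrc /etgt => E1 E2; apply: val_inj; case: (val i) (val j) E1 E2 => ? ? [? ?] /= -> ->.
Qed.

Definition inc (i : edge_type) x := (esrc i == x) || (etgt i == x).

Lemma inc_other (i : edge_type) x : inc i x -> exists2 y, y != x & inc i y.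
Proof.
case/orP=> /eqP<-; [exists (etgt i) | exists (esrc i)]; rewrite /inc ?eqxx ?orbT //.
  by rewrite eq_sym esrc_neq.
exact: esrc_neq.
Qed.

Lemma inc_ends (i : edge_type) x y : x != y -> inc i x -> inc i y ->
  esrc i = x /\ etgt i = y \/ esrc i = y /\ etgt i = x.
Proof.
move=> nxy /orP[]/eqP Ex /orP[]/eqP Ey; try (by left); try (by right);
  by rewrite -Ex -Ey eqxx in nxy.
Qed.

Lemma inc_inj (i j : edge_type) x y :
  x != y -> inc i x -> inc i y -> inc j x -> inc j y -> i = j.
Proof.
move=> nxy ix iy jx jy; have := esrc_lt i; have := esrc_lt j.
case: (inc_ends nxy ix iy) => -[Ei Ei']; case: (inc_ends nxy jx jy) => -[Ej Ej'];
  rewrite Ei Ei' Ej Ej' => l1 l2; try (by apply: edge_type_eq; congruence).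
all: by have := ltn_trans l1 l2; rewrite ltnn.
Qed.

Lemma sum_inc (i : edge_type) : \sum_x inc i x = 2.
Proof.
have -> : 2 = #|[set esrc i; etgt i]| by rewrite cards2 esrc_neq.
rewrite -sum1_card [RHS]big_mkcond /=; apply: eq_bigr => x _.
by rewrite !inE /inc !(eq_sym x); case: (_ || _).
Qed.

Lemma handshake : \sum_x #|[set y | e x y]| = 2 * #|edge_type|.
Proof.
pose lt (x y : T) := enum_rank x < enum_rank y.
have -> : #|edge_type| = \sum_x \sum_y (e x y && lt x y).
  rewrite card_sig -sum1_card big_mkcond /= pair_big /=.
  apply: eq_bigr => p _; rewrite -[RHS]/(nat_of_bool (is_edge p)) unfold_in /=.
  by case: is_edge.
have split x y : e x y = (e x y && lt x y) + (e x y && lt y x) :> nat.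
  rewrite /lt; case: (ltngtP (enum_rank x) (enum_rank y)) => [_|_|/val_inj/enum_rank_inj->].
  - by rewrite andbF andbT addn0.
  - by rewrite andbF andbT.
  - by rewrite (proj2 e_simple).
transitivity (\sum_x \sum_y (e x y && lt x y) + \sum_x \sum_y (e x y && lt y x)).
  rewrite -big_split; apply: eq_bigr => x _; rewrite -big_split -sum1dep_card big_mkcond /=.
  by apply: eq_bigr => y _; rewrite -split; case: (e x y).
rewrite mul2n -addnn; congr (_ + _); rewrite exchange_big; apply: eq_bigr => x _.
by apply: eq_bigr => y _; rewrite (proj1 e_simple).
Qed.

(** A vertex that meets [D] meets at least two of its edges, so [D] contains a cycle. It has at
    least 8 vertices, and counting incidences there gives [2 * 8 <= 2 * #|D|]. *)
Lemma even_edge_set (D : {set edge_type}) : D != set0 ->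
  (forall v, bd esrc etgt (fun i => i \in D) v = false) -> 8 <= #|D|.
Proof.
move=> /set0Pn[i0 i0D] even.
pose incD x := [set i in D | inc i x].
have evenD x : ~~ odd #|incD x|.
  apply/negbT; rewrite -[RHS](even x) /bd -sum_bool_odd; apply: eq_bigr => i _.
  rewrite /inc; have := esrc_neq i.
  case Es: (esrc i == x); case Et: (etgt i == x); case: (i \in D) => //.
  by rewrite (eqP Es) (eqP Et) eqxx.
pose d := [rel x y | [exists i in D, inc i x && inc i y && (x != y)]].
have d_sym : symmetric d.
  by move=> x y /=; apply: eq_existsb => i; rewrite [y == x]eq_sym [inc i y && _]andbC.
have dP x y : d x y -> e x y.
  case/existsP=> i /and3P[_ /andP[/orP[]/eqP Ex /orP[]/eqP Ey] nxy].
  - by rewrite -Ex -Ey eqxx in nxy.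
  - by rewrite -Ex -Ey esrc_etgt.
  - by rewrite -Ex -Ey (proj1 e_simple) esrc_etgt.
  - by rewrite -Ex -Ey eqxx in nxy.
have d_irr : irreflexive d.
  by move=> x; apply/negbTE/negP => /dP; rewrite (proj2 e_simple).
have inc2 x i : i \in incD x -> 2 <= #|incD x|.
  move=> ix; have := evenD x; have : 0 < #|incD x| by rewrite (cardD1 i) ix.
  by case: #|incD x| => [|[|]].
have d0 : d (esrc i0) (etgt i0).
  by apply/existsP; exists i0; rewrite i0D /inc !eqxx orbT esrc_neq.
have [|s [us cs s3]] := mindeg2_cycle d_sym d_irr d0.
  move=> u v /existsP[i /and3P[iD /andP[iu iv] nuv]].
  have : i \in incD u by rewrite inE iD.
  move=> iDu; have := inc2 _ _ iDu; rewrite (cardsD1 i) iDu ltnS => /card_gt0P[j].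
  rewrite !inE => /and3P[ji jD ju].
  have [w wu jw] := inc_other ju; exists w.
    by apply: contraNneq ji => Ewv; subst w; apply/eqP; apply: inc_inj nuv ju jw iu iv.
  by apply/existsP; exists j; rewrite jD ju jw eq_sym.
have s8 := e_girth us (sub_cycle dP cs) s3.
apply: (leq_trans s8); rewrite -(leq_pmul2l (m := 2)) //.
have -> : 2 * #|D| = \sum_(i in D) \sum_x inc i x.
  by rewrite (eq_bigr (fun=> 2)) => [|i _]; rewrite ?sum_inc // sum_nat_const mulnC.
rewrite exchange_big /=; apply: (@leq_trans (\sum_(x in s) 2)).
  by rewrite sum_nat_const mulnC leq_mul2r /= (card_uniqP us).
rewrite [X in _ <= X](bigID (mem s)) /= -[X in X <= _]addn0 leq_add //.
apply: leq_sum => x xs.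
have /existsP[i /and3P[iD /andP[ix _] _]] := next_cycle cs xs.
have := inc2 x i; rewrite inE iD ix => /(_ isT)/leq_trans; apply.
by rewrite -sum1dep_card big_mkcondr /= leq_sum // => j _; case: inc.
Qed.

Lemma grid_minor_sparse n (fib : T -> {set torus n}) (ctr : T -> torus n) (x0 : T) :
  (forall v q, q \in fib v -> (q.1 != 0%R) && (q.2 != 0%R)) ->
  (forall u v q, q \in fib u -> q \in fib v -> u = v) ->
  (forall v q, q \in fib v ->
     connect [rel a b | [&& tadj a b, a \in fib v & b \in fib v]] (ctr v) q) ->
  (forall x y, e x y -> exists q q', [/\ tadj q q', q \in fib x & q' \in fib y]) ->
  3 * (\sum_x #|[set y | e x y]|) < 8 * #|T|.
Proof.
move=> off0 disj conn edges.
have /choice[rho rho_ends] : forall i : edge_type, exists a : torus_edge n,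
  (end1 a \in fib (esrc i)) && (end2 a \in fib (etgt i)) ||
  (end1 a \in fib (etgt i)) && (end2 a \in fib (esrc i)).
  move=> i; have [q [q' [/existsP[a Ha] qx qy]]] := edges _ _ (esrc_etgt i).
  by exists a; case/orP: Ha => /andP[/eqP-> /eqP->]; rewrite qx qy ?orbT.
(* The branch sets at the ends of [rho i] recover the ends of [i], and these determine the edge. *)
have rho_inj : injective rho.
  have ends i : [set esrc i; etgt i] =
      [set v | (end1 (rho i) \in fib v) || (end2 (rho i) \in fib v)].
    apply/setP => v; rewrite !inE !(eq_sym v).
    by case/orP: (rho_ends i) => /andP[h1 h2];
      rewrite (in_fib disj v h1) (in_fib disj v h2) // orbC.
  move=> i j Eij; have E := ends i; rewrite Eij -ends in E.
  have incE k x : inc k x = (x \in [set esrc k; etgt k]) by rewrite !inE /inc !(eq_sym x).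
  by apply: (inc_inj (esrc_neq i)); rewrite !incE -?E !inE eqxx ?orbT.
(* With girth 8 the inequality becomes [6 * #|edge_type| <= 8 * #|T|.-1]. *)
have := grid_minor_edges esrc_neq off0 disj conn rho_inj rho_ends x0 even_edge_set.
have : 0 < #|T| by apply/card_gt0P; exists x0.
rewrite handshake; lia.
Qed.
End EdgeCount.

(** * Branch sets from boxes [B] around vertices and corridors [W] along arcs *)

Section DiscreteDrawing.
Variables (T : finType) (e : rel T) (n : nat).
Hypothesis e_simple : simple_graph e.
Variables (c : T -> torus n) (B : T -> {set torus n}) (W : T -> T -> {set torus n}).

Definition adj_in (X : {set torus n}) : rel (torus n) :=
  [rel a b | [&& tadj a b, a \in X & b \in X]].

Hypothesis B_off0 : forall x q, q \in B x -> (q.1 != 0%R) && (q.2 != 0%R).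
Hypothesis W_off0 : forall x y q, q \in W x y -> (q.1 != 0%R) && (q.2 != 0%R).
Hypothesis B_disj : forall x y q, q \in B x -> q \in B y -> x = y.
Hypothesis B_ctr : forall x, c x \in B x.
Hypothesis B_conn : forall x q, q \in B x -> connect (adj_in (B x)) (c x) q.
Hypothesis W_conn : forall x y, e x y -> connect (adj_in (W x y)) (c x) (c y).
Hypothesis W_B : forall x y z q, e x y -> q \in W x y -> q \in B z -> z = x \/ z = y.
Hypothesis W_W : forall x y x' y' q, e x y -> e x' y' -> q \in W x y -> q \in W x' y' ->
  q \notin B x -> q \notin B y -> (x' = x /\ y' = y) \/ (x' = y /\ y' = x).

(* Every arc is absorbed by the branch set of its end of smaller rank. *)
Definition territory x : {set torus n} := B x :|:
  [set q | [exists y, [&& e x y, enum_rank x < enum_rank y, q \in W x y,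
                          q \notin B x & q \notin B y]]].

(** Only the component of the centre is kept, because removing the boxes can cut a corridor into
    pieces. *)
Definition branch x : {set torus n} := [set q | connect (adj_in (territory x)) (c x) q].

Lemma tadj_sym : symmetric (@tadj n).
Proof. by move=> q q'; apply: eq_existsb => a; rewrite orbC. Qed.

Lemma ctr_branch x : c x \in branch x.
Proof. by rewrite inE connect0. Qed.

Lemma ctr_territory x : c x \in territory x.
Proof. by rewrite inE B_ctr. Qed.

Lemma branch_territory x q : q \in branch x -> q \in territory x.
Proof.
rewrite inE => /connectP[p]; case/lastP: p => [_ ->|p q']; first exact: ctr_territory.
by rewrite rcons_path last_rcons => /andP[_ /and3P[_ _ h]] ->.
Qed.

Lemma branch_step x q q' : q \in branch x -> tadj q q' -> q' \in territory x -> q' \in branch x.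
Proof.
move=> qx qq' q'x; have qt := branch_territory qx; move: qx; rewrite !inE => qx.
by apply: connect_trans qx (connect1 _); rewrite /adj_in /= qq' qt.
Qed.

Lemma branch_conn x q : q \in branch x -> connect (adj_in (branch x)) (c x) q.
Proof.
rewrite inE => /connectP[p]; elim: p (c x) (ctr_branch x) => [|a p IH] b bx /=.
  by move=> _ ->.
move=> /andP[/and3P[ba _ ax] pa] qE; have abr := branch_step bx ba ax.
by apply: connect_trans (IH a abr pa qE); apply: connect1; rewrite /adj_in /= ba bx.
Qed.

Lemma B_branch x q : q \in B x -> q \in branch x.
Proof.
move=> /B_conn/connectP[p]; elim: p (c x) (ctr_branch x) => [|a p IH] b bx /=.
  by move=> _ ->.
move=> /andP[/and3P[ba _ ax] pa]; apply: IH => //.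
by apply: branch_step bx ba _; rewrite inE ax.
Qed.

(** A corridor meets only the boxes of its own ends, and outside these two corridors meet only if
    they follow the same edge, whose owner is fixed by rank. *)
Lemma territory_disj x y q : q \in territory x -> q \in territory y -> x = y.
Proof.
rewrite !in_setU !in_set => /orP[qx|/existsP[x' /and5P[ex ltx Wx nx nx']]].
  case/orP=> [/(B_disj qx)//|/existsP[y' /and5P[ey lty Wy ny ny']]].
  by case: (W_B ey Wy qx) => E; rewrite -E qx in ny ny'.
case/orP=> [qy|/existsP[y' /and5P[ey lty Wy ny ny']]].
  by case: (W_B ex Wx qy) => E; rewrite -E qy in nx nx'.
case: (W_W ex ey Wx Wy nx nx') => -[Ey Ey']; first by rewrite Ey.
by have := ltn_trans ltx; rewrite -Ey => /(_ _ lty); rewrite Ey' ltnn.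
Qed.

Lemma branch_disj x y q : q \in branch x -> q \in branch y -> x = y.
Proof. by move=> /branch_territory qx /branch_territory; apply: territory_disj. Qed.

Lemma branch_off0 x q : q \in branch x -> (q.1 != 0%R) && (q.2 != 0%R).
Proof.
move=> /branch_territory; rewrite in_setU in_set => /orP[/B_off0//|].
by case/existsP=> y /and5P[_ _ /W_off0].
Qed.

(** Along the corridor from [c x] to [c y], the first vertex outside [branch x] lies in [B y];
    otherwise it would extend the branch set. *)
Lemma branch_edge_lt x y : e x y -> enum_rank x < enum_rank y ->
  exists q q', [/\ tadj q q', q \in branch x & q' \in branch y].
Proof.
move=> exy ltxy; case/connectP: (W_conn exy) => p.
elim: p (c x) (ctr_branch x) => [|b p IH] a ax /=.
  move=> _ E; move: (ctr_branch y); rewrite E => /(branch_disj ax) Exy.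
  by rewrite Exy ltnn in ltxy.
move=> /andP[/and3P[ab _ bW] pb]; have [bx|nbx] := boolP (b \in branch x); first exact: IH.
move=> _; exists a, b; split=> //; apply: B_branch.
have [//|nby] := boolP (b \in B y); case/negP: nbx; apply: (branch_step ax ab).
rewrite in_setU in_set; have [//|nbx'] := boolP (b \in B x).
by apply/existsP; exists y; rewrite exy ltxy bW nby ?nbx'.
Qed.

Lemma discrete_drawing_sparse (x0 : T) : girth_at_least e 8 ->
  3 * (\sum_x #|[set y | e x y]|) < 8 * #|T|.
Proof.
move=> g8; apply: (grid_minor_sparse e_simple g8 x0 branch_off0 branch_disj branch_conn).
move=> x y exy; case: (ltngtP (enum_rank x) (enum_rank y)) => [lt|lt|/val_inj/enum_rank_inj E].
- exact: branch_edge_lt.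
- have eyx : e y x by rewrite (proj1 e_simple).
  have [q [q' [qq' qy q'x]]] := branch_edge_lt eyx lt.
  by exists q', q; rewrite tadj_sym.
- by rewrite E (proj2 e_simple) in exy.
Qed.

End DiscreteDrawing.

(** * From plane drawings to grid minors *)

Section PlaneCurves.
Local Open Scope R_scope.

(** Distance below [r] in the maximum norm, which fits the grid and keeps all estimates linear. *)
Definition near (p q : R * R) (r : R) : Prop :=
  (- r < p.1 - q.1 < r) /\ (- r < p.2 - q.2 < r).

Definition curve_cont (G : R -> R * R) : Prop :=
  forall t eps, 0 < eps -> exists d, 0 < d /\ forall s, t - d < s < t + d -> near (G s) (G t) eps.

Lemma near_sym p q r : near p q r -> near q p r.
Proof. by rewrite /near; lra. Qed.

Lemma near_trans p q s r1 r2 : near p q r1 -> near q s r2 -> near p s (r1 + r2).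
Proof. by rewrite /near; lra. Qed.

Lemma near_le p q r1 r2 : r1 <= r2 -> near p q r1 -> near p q r2.
Proof. by rewrite /near; lra. Qed.

Lemma near_refl p r : 0 < r -> near p p r.
Proof. by rewrite /near; lra. Qed.

Lemma near_open p q r : near p q r ->
  exists r', 0 < r' /\ forall p', near p' p r' -> near p' q r.
Proof.
move=> [[h1 h2] [h3 h4]].
exists (Rmin (Rmin (r + (p.1 - q.1)) (r - (p.1 - q.1)))
             (Rmin (r + (p.2 - q.2)) (r - (p.2 - q.2)))); split.
  by repeat apply: Rmin_glb_lt; lra.
move=> p'; set a := Rmin (Rmin _ _) _.
have [a1 a2] : a <= r + (p.1 - q.1) /\ a <= r - (p.1 - q.1).
  by split; apply: Rle_trans (Rmin_l _ _) _; [apply: Rmin_l|apply: Rmin_r].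
have [a3 a4] : a <= r + (p.2 - q.2) /\ a <= r - (p.2 - q.2).
  by split; apply: Rle_trans (Rmin_r _ _) _; [apply: Rmin_l|apply: Rmin_r].
by rewrite /near; lra.
Qed.

Lemma neq_not_near p q : p <> q -> exists r, 0 < r /\ ~ near p q r.
Proof.
case: p q => [p1 p2] [q1 q2] npq.
have [E1|n1] := Req_dec p1 q1; last first.
  exists (Rabs (p1 - q1)); split; first by apply: Rabs_pos_lt; lra.
  by rewrite /near /= /Rabs; case: Rcase_abs; lra.
have n2 : p2 <> q2 by move=> E2; apply: npq; rewrite E1 E2.
exists (Rabs (p2 - q2)); split; first by apply: Rabs_pos_lt; lra.
by rewrite /near /= /Rabs; case: Rcase_abs; lra.
Qed.

Definition antitone (Q : R -> Prop) := forall h h', 0 < h' -> h' <= h -> Q h -> Q h'.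

(** Compactness in terms of scales: a scale valid locally around each parameter can be chosen
    uniformly. The proof takes the supremum of all [s] such that one scale serves on [[0, s]]. *)
Lemma unit_interval_compact (P : R -> R -> Prop) : (forall t, antitone (P t)) ->
  (forall t, 0 <= t <= 1 -> exists h, 0 < h /\
     forall t', 0 <= t' <= 1 -> t - h < t' < t + h -> P t' h) ->
  exists h, 0 < h /\ forall t, 0 <= t <= 1 -> P t h.
Proof.
move=> anti loc.
pose E s := 0 <= s <= 1 /\ exists h, 0 < h /\ forall t, 0 <= t <= s -> P t h.
have E0 : E 0.
  split; first lra; have [h [h0 Hh]] := loc 0 ltac:(lra).
  by exists h; split=> // t t0; apply: Hh; lra.
have [m [mub mlub]] : {m | is_lub E m}.
  by apply: completeness; [exists 1 => s [] [] | exists 0].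
have m0 : 0 <= m by apply: mub.
have m1 : m <= 1 by apply: mlub => s [] [].
have [h [h0 Hh]] := loc m (conj m0 m1).
have [s [Es ltms]] : exists s, E s /\ m - h < s.
  apply: contrapT => nE; suff : m <= m - h by lra.
  apply: mlub => s Es; apply: Rnot_lt_le => lt; apply: nE; by exists s.
have [[s0 s1] [k [k0 Hk]]] := Es.
have sm : s <= m := mub _ Es.
have all t : 0 <= t -> t <= 1 -> t < m + h -> P t (Rmin h k).
  move=> t0 t1 tm; have hk : 0 < Rmin h k by apply: Rmin_glb_lt.
  have [ts|ts] := Rle_lt_dec t s.
    by apply: (anti t k) (Hk t (conj t0 ts)) => //; apply: Rmin_r.
  by apply: (anti t h) (Hh t (conj t0 t1) _) => //; [apply: Rmin_l | lra].
have m1' : m = 1.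
  apply: Rle_antisym => //; apply: Rnot_lt_le => lt1.
  suff : Rmin 1 (m + h / 2) <= m by rewrite /Rmin; case: Rle_dec; lra.
  apply: mub; split; first by rewrite /Rmin; case: Rle_dec; lra.
  exists (Rmin h k); split; first exact: Rmin_glb_lt.
  move=> t [t0 tm]; apply: all => //.
    by apply: Rle_trans tm (Rmin_l _ _).
  by move: (Rmin_r 1 (m + h / 2)); lra.
exists (Rmin h k); split; first exact: Rmin_glb_lt.
by move=> t [t0 t1]; apply: all; lra.
Qed.

Lemma finite_pos (I : finType) (Q : I -> R -> Prop) : (forall i, antitone (Q i)) ->
  (forall i, exists h, 0 < h /\ Q i h) -> exists h, 0 < h /\ forall i, Q i h.
Proof.
move=> anti loc.
suff [h [h0 Hh]] : exists h, 0 < h /\ forall i, i \in enum I -> Q i h.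
  by exists h; split=> // i; apply: Hh; rewrite mem_enum.
elim: (enum I) => [|i s [h [h0 Hh]]]; first by exists 1; split; [lra|].
have [k [k0 Hk]] := loc i; exists (Rmin h k); split; first exact: Rmin_glb_lt.
have hk : 0 < Rmin h k by apply: Rmin_glb_lt.
move=> j; rewrite inE => /orP[/eqP->|js].
  by apply: (anti i k) => //; apply: Rmin_r.
by apply: (anti j h) (Hh j js) => //; apply: Rmin_l.
Qed.

Lemma curve_uniform_cont G eps : curve_cont G -> 0 < eps -> exists d, 0 < d /\
  forall t s, 0 <= t <= 1 -> 0 <= s <= 1 -> - d < s - t < d -> near (G s) (G t) eps.
Proof.
move=> cG eps0.
have [||d [d0 Hd]] := @unit_interval_compact (fun t d =>
  forall s, 0 <= s <= 1 -> - d < s - t < d -> near (G s) (G t) eps).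
- by move=> t h h' h0 hh' H s s01 st; apply: H => //; lra.
- move=> t _; have [d [d0 Hd]] := cG t (eps / 2) ltac:(lra).
  exists (d / 2); split; first lra.
  move=> t' _ tt' s _ st'.
  have n1 : near (G s) (G t) (eps / 2) by apply: Hd; lra.
  have n2 : near (G t') (G t) (eps / 2) by apply: Hd; lra.
  by apply: near_le (near_trans n1 (near_sym n2)); lra.
- by exists d; split=> // t s t01 s01 st; apply: Hd.
Qed.

(** The bound is written [/ h] so that the property is antitone in [h] and compactness applies. *)
Lemma curve_bounded G : curve_cont G -> exists h, 0 < h /\
  forall t, 0 <= t <= 1 -> near (G t) (0, 0) (/ h).
Proof.
move=> cG; apply: unit_interval_compact => [t h h' h0 hh'|t _].
  by apply: near_le; apply: Rinv_le_contravar.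
have [d [d0 Hd]] := cG t 1 ltac:(lra).
pose M := Rabs (G t).1 + Rabs (G t).2 + 1.
have M1 : 1 <= M by rewrite /M; move: (Rabs_pos (G t).1) (Rabs_pos (G t).2); lra.
have GM : near (G t) (0, 0) M.
  rewrite /near /M /=; move: (Rle_abs (G t).1) (Rle_abs (- (G t).1)) (Rabs_pos (G t).1).
  move: (Rle_abs (G t).2) (Rle_abs (- (G t).2)) (Rabs_pos (G t).2).
  by rewrite !Rabs_Ropp; lra.
have k0 : 0 < / (M + 1) by apply: Rinv_0_lt_compat; lra.
exists (Rmin d (/ (M + 1))); split; first exact: Rmin_glb_lt.
move=> t' _ tt'; have tt : t - d < t' < t + d by move: (Rmin_l d (/ (M + 1))); lra.
apply: near_le (near_trans (Hd _ tt) GM); rewrite -[1 + M]Rinv_inv.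
by apply: Rinv_le_contravar; [apply: Rmin_glb_lt | rewrite Rplus_comm; apply: Rmin_r].
Qed.

Lemma curve_avoid_point G p : curve_cont G -> (forall t, 0 <= t <= 1 -> G t <> p) ->
  exists r, 0 < r /\ forall t, 0 <= t <= 1 -> ~ near (G t) p r.
Proof.
move=> cG Gp; apply: unit_interval_compact => [t h h' h0 hh' H|t t01].
  by move=> n; apply: H; apply: near_le n.
have [r [r0 nr]] := neq_not_near (Gp t t01).
have [d [d0 Hd]] := cG t (r / 2) ltac:(lra).
exists (Rmin d (r / 2)); split; first by apply: Rmin_glb_lt; lra.
move=> t' _ tt' n; apply: nr.
have tt : t - d < t' < t + d by move: (Rmin_l d (r / 2)); lra.
by apply: near_le (near_trans (near_sym (Hd _ tt)) n); move: (Rmin_r d (r / 2)); lra.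
Qed.

(** The squares around [p] and [q] are open: inside them the claim is locally vacuous, and elsewhere
    [G t] has positive distance from the compact curve [G']. *)
Lemma curves_separated G G' p q r : curve_cont G -> curve_cont G' ->
  (forall t s, 0 <= t <= 1 -> 0 <= s <= 1 -> ~ near (G t) p r -> ~ near (G t) q r ->
     G t <> G' s) ->
  exists h, 0 < h /\ forall t, 0 <= t <= 1 -> ~ near (G t) p r -> ~ near (G t) q r ->
    forall s, 0 <= s <= 1 -> ~ near (G t) (G' s) h.
Proof.
move=> cG cG' sep; apply: unit_interval_compact => [t h h' h0 hh' H np nq s s01 n|t t01].
  by apply: (H np nq s s01); apply: near_le n.
have vac x : near (G t) x r -> exists h, 0 < h /\
    forall t', 0 <= t' <= 1 -> t - h < t' < t + h -> near (G t') x r.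
  move=> /near_open[r' [r'0 Hr']]; have [d [d0 Hd]] := cG t r' r'0.
  by exists d; split=> // t' _ tt'; apply: Hr'; apply: Hd.
have [np|np] := pselect (near (G t) p r).
  have [h [h0 Hh]] := vac _ np; exists h; split=> // t' t'01 tt' n.
  by case: n; apply: Hh.
have [nq|nq] := pselect (near (G t) q r).
  have [h [h0 Hh]] := vac _ nq; exists h; split=> // t' t'01 tt' _ n.
  by case: n; apply: Hh.
have [|rho [rho0 Hrho]] := curve_avoid_point (p := G t) cG'.
  by move=> s s01 E; apply: (sep t s).
have [d [d0 Hd]] := cG t (rho / 2) ltac:(lra).
exists (Rmin d (rho / 2)); split; first by apply: Rmin_glb_lt; lra.
move=> t' _ tt' _ _ s s01 n; apply: (Hrho s s01).
have tt : t - d < t' < t + d by move: (Rmin_l d (rho / 2)); lra.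
by apply: near_le (near_trans (near_sym n) (Hd _ tt)); move: (Rmin_r d (rho / 2)); lra.
Qed.

Lemma clamp01_id t : 0 <= t <= 1 -> clamp01 t = t.
Proof. by move=> [t0 t1]; rewrite /clamp01 Rmin_right // Rmax_right. Qed.

Lemma continuity_eps f t eps : continuity f -> 0 < eps ->
  exists d, 0 < d /\ forall s, t - d < s < t + d -> - eps < f s - f t < eps.
Proof.
move=> cf eps0; have [d [d0 Hd]] := cf t eps eps0; exists d; split=> // s st.
have [->|ns] := Req_dec s t; first lra.
have := Hd s; rewrite /dist /= /Rdist /D_x /no_cond => H.
have lt : Rabs (s - t) < d by apply: Rabs_def1; lra.
by move: (Rabs_def2 _ _ (H (conj (conj I (not_eq_sym ns)) lt))); lra.
Qed.

Lemma curve_contP G : continuity (fun t => (G t).1) -> continuity (fun t => (G t).2) ->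
  curve_cont G.
Proof.
move=> c1 c2 t eps eps0.
have [d1 [d10 H1]] := continuity_eps t c1 eps0.
have [d2 [d20 H2]] := continuity_eps t c2 eps0.
exists (Rmin d1 d2); split; first exact: Rmin_glb_lt.
move=> s st; move: (Rmin_l d1 d2) (Rmin_r d1 d2) => l1 l2.
by split; [apply: H1 | apply: H2]; lra.
Qed.

End PlaneCurves.

(** * Connectedness in the grid and rounding of points *)

Lemma ord_succ n (i i' : 'I_n.+2) : i' = i.+1 :> nat -> i' = (i + 1)%R.
Proof.
by move=> ii'; apply: val_inj; rewrite /= [1 %% _]modn_small // addn1 -ii' modn_small.
Qed.

Lemma tadj_h n (i i' j : 'I_n.+2) : i' = i.+1 :> nat -> tadj (i, j) (i', j).
Proof.
move=> /ord_succ->; apply/existsP; exists (true, (i, j)); rewrite eqxx /=.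
by apply/orP; left; apply/eqP; rewrite -[in RHS](addr0 j).
Qed.

Lemma tadj_v n (i j j' : 'I_n.+2) : j' = j.+1 :> nat -> tadj (i, j) (i, j').
Proof.
move=> /ord_succ->; apply/existsP; exists (false, (i, j)); rewrite eqxx /=.
by apply/orP; left; apply/eqP; rewrite -[in RHS](addr0 i).
Qed.

Lemma adj_in_sym n (X : {set torus n}) : symmetric (adj_in X).
Proof. by move=> a b; rewrite /adj_in /= tadj_sym [(a \in X) && _]andbC. Qed.

Lemma connect_adj_in_sym n (X : {set torus n}) : connect_sym (adj_in X).
Proof. exact: sym_connect_sym (@adj_in_sym n X). Qed.

Lemma connect_h n (X : {set torus n}) (i i' j : 'I_n.+2) : i <= i' ->
  (forall k : 'I_n.+2, i <= k <= i' -> (k, j) \in X) ->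
  connect (adj_in X) (i, j) (i', j).
Proof.
move=> le; have [m] := ubnP (i' - i); elim: m i' le => // m IH i' le lt inX.
have [E|ne] := eqVneq (nat_of_ord i) i'; first by rewrite (val_inj E) connect0.
have lt' : (i'.-1 < n.+2)%N by have := ltn_ord i'; lia.
pose k := Ordinal lt'; have kE : i' = k.+1 :> nat by rewrite /=; lia.
apply: (@connect_trans _ _ (k, j)); last apply: connect1.
  by apply: IH => [||l ll]; [lia | lia | apply: inX; lia].
by rewrite /adj_in /= tadj_h // !inX; lia.
Qed.

Lemma connect_v n (X : {set torus n}) (i j j' : 'I_n.+2) : j <= j' ->
  (forall k : 'I_n.+2, j <= k <= j' -> (i, k) \in X) ->
  connect (adj_in X) (i, j) (i, j').
Proof.
move=> le; have [m] := ubnP (j' - j); elim: m j' le => // m IH j' le lt inX.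
have [E|ne] := eqVneq (nat_of_ord j) j'; first by rewrite (val_inj E) connect0.
have lt' : (j'.-1 < n.+2)%N by have := ltn_ord j'; lia.
pose k := Ordinal lt'; have kE : j' = k.+1 :> nat by rewrite /=; lia.
apply: (@connect_trans _ _ (i, k)); last apply: connect1.
  by apply: IH => [||l ll]; [lia | lia | apply: inX; lia].
by rewrite /adj_in /= tadj_v // !inX; lia.
Qed.

Definition rect n (l1 u1 l2 u2 : nat) : {set torus n} :=
  [set q : torus n | (l1 <= q.1 <= u1) && (l2 <= q.2 <= u2)].

Lemma rect_conn n l1 u1 l2 u2 (q q' : torus n) :
  q \in rect n l1 u1 l2 u2 -> q' \in rect n l1 u1 l2 u2 ->
  connect (adj_in (rect n l1 u1 l2 u2)) q q'.
Proof.
case: q q' => [i j] [i' j']; rewrite !inE /= => /andP[ri rj] /andP[ri' rj'].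
apply: (@connect_trans _ _ (i', j)).
  case/orP: (leq_total i i') => le; last rewrite connect_adj_in_sym.
    by apply: connect_h => // k kk; rewrite inE /=; lia.
  by apply: connect_h => // k kk; rewrite inE /=; lia.
case/orP: (leq_total j j') => le; last rewrite connect_adj_in_sym.
  by apply: connect_v => // k kk; rewrite inE /=; lia.
by apply: connect_v => // k kk; rewrite inE /=; lia.
Qed.

Section Rounding.
Local Open Scope R_scope.
Variables (h M : R) (n : nat).
Hypothesis h_pos : 0 < h.
Hypothesis n_large : 2 * M < INR n * h.

(** The successor keeps index 0 free, as the branch sets require. *)
Definition grid_index (y : R) : nat := (Z.to_nat (Int_part ((y + M) / h))).+1.
Definition grid_pos (k : nat) : R := INR k * h - M.

Lemma grid_index_spec y : - M < y ->
  grid_pos (grid_index y) - h <= y < grid_pos (grid_index y).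
Proof.
move=> yM; rewrite /grid_pos /grid_index S_INR.
set z := Int_part _; have [z1 z2] := base_Int_part ((y + M) / h); rewrite -/z in z1 z2.
have q0 : 0 < (y + M) / h by apply: Rdiv_lt_0_compat; lra.
have z0 : Z.le 0 z by apply/Z.lt_succ_r; apply: lt_IZR; rewrite succ_IZR; lra.
rewrite INR_IZR_INZ Z2Nat.id //.
have E : (y + M) / h * h = y + M by field; lra.
by split; nra.
Qed.

Lemma grid_index_lt y : - M < y < M -> (grid_index y < n.+2)%N.
Proof.
move=> [y1 y2]; move: (grid_index y) (grid_index_spec y1) => k [h1 h2].
apply/ltP; apply: INR_lt; apply: (Rmult_lt_reg_r h) => //.
by rewrite !S_INR; rewrite /grid_pos in h1 h2; lra.
Qed.

Lemma grid_pos_le k k' m : (k <= k' + m)%N -> grid_pos k <= grid_pos k' + INR m * h.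
Proof.
move=> /leP/le_INR; rewrite plus_INR /grid_pos => le.
by have := Rmult_le_compat_r h _ _ (Rlt_le _ _ h_pos) le; lra.
Qed.

Lemma grid_pos_lt k k' m : grid_pos k < grid_pos k' + INR m * h -> (k < k' + m)%N.
Proof.
rewrite /grid_pos => lt; apply/ltP; apply: INR_lt; rewrite plus_INR.
by apply: (Rmult_lt_reg_r h) => //; lra.
Qed.

Definition grid_round (y : R * R) : torus n := (inord (grid_index y.1), inord (grid_index y.2)).
Definition torus_pos (q : torus n) : R * R := (grid_pos q.1, grid_pos q.2).

Lemma grid_round_val y : near y (0, 0) M ->
  (grid_round y).1 = grid_index y.1 :> nat /\ (grid_round y).2 = grid_index y.2 :> nat.
Proof. by move=> [] /= n1 n2; rewrite !inordK //; apply: grid_index_lt; lra. Qed.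

Lemma grid_round_gt0 y : near y (0, 0) M ->
  (0 < (grid_round y).1)%N /\ (0 < (grid_round y).2)%N.
Proof. by case/grid_round_val => -> ->. Qed.

Lemma grid_index_near y y' : - M < y -> - M < y' -> - h < y - y' < h ->
  (grid_index y <= (grid_index y').+1)%N.
Proof.
move=> yM yM' yy'.
move: (grid_index y) (grid_index_spec yM) (grid_index y') (grid_index_spec yM').
move=> k [h1 h2] k' [h3 h4].
apply/leP; apply: le_S_n; apply: INR_lt; apply: (Rmult_lt_reg_r h) => //.
by rewrite !S_INR; move: h1 h2 h3 h4; rewrite /grid_pos; lra.
Qed.

Lemma torus_pos_round y : near y (0, 0) M ->
  (0 < (torus_pos (grid_round y)).1 - y.1 <= h) /\
  (0 < (torus_pos (grid_round y)).2 - y.2 <= h).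
Proof.
move=> yM; rewrite /torus_pos; have [-> ->] := grid_round_val yM; case: yM => /= n1 n2.
have [|h1 h2] := @grid_index_spec y.1; first lra.
have [|h3 h4] := @grid_index_spec y.2; first lra.
by lra.
Qed.

Lemma grid_round_near y : near y (0, 0) M -> near (torus_pos (grid_round y)) y (2 * h).
Proof. by move/torus_pos_round; rewrite /near; lra. Qed.

(** The rounded points differ by at most one in each coordinate, so they are joined through one
    corner; all three grid points are within [2 * h] of [y]. *)
Lemma grid_round_step (X : {set torus n}) y y' :
  near y (0, 0) M -> near y' (0, 0) M -> near y' y h ->
  (forall q : torus n, (0 < q.1)%N -> (0 < q.2)%N -> near (torus_pos q) y (2 * h) -> q \in X) ->
  connect (adj_in X) (grid_round y) (grid_round y').
Proof.
move=> yM yM' yy' inX.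
have [v1 v2] := grid_round_val yM; have [v1' v2'] := grid_round_val yM'.
have [p1 p2] := torus_pos_round yM; have [p1' p2'] := torus_pos_round yM'.
have [g1 g2] := grid_round_gt0 yM; have [g1' g2'] := grid_round_gt0 yM'.
have [b1 b2] : ((grid_round y).1 <= (grid_round y').1.+1)%N /\
    ((grid_round y).2 <= (grid_round y').2.+1)%N.
  by rewrite v1 v2 v1' v2'; split; apply: grid_index_near; case: yM yM' yy' => /= ? ? [] /= ? ? [];
    lra.
have [b1' b2'] : ((grid_round y').1 <= (grid_round y).1.+1)%N /\
    ((grid_round y').2 <= (grid_round y).2.+1)%N.
  by rewrite v1 v2 v1' v2'; split; apply: grid_index_near; case: yM yM' yy' => /= ? ? [] /= ? ? [];
    lra.
have in1 : grid_round y \in X by apply: inX => //; rewrite /near; lra.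
have in2 : grid_round y' \in X by apply: inX => //; move: yy'; rewrite /near; lra.
have in3 : ((grid_round y').1, (grid_round y).2) \in X.
  by apply: inX => //; move: yy' p1' p2; rewrite /near /torus_pos /=; lra.
move: in1 in2 in3 b1 b2 b1' b2'.
case: (grid_round y) (grid_round y') => [i j] [i' j'] /= in1 in2 in3 b1 b2 b1' b2'.
apply: (@connect_trans _ _ (i', j)).
  have mid (k : 'I_n.+2) : nat_of_ord k = i \/ nat_of_ord k = i' -> (k, j) \in X.
    by case=> /val_inj->.
  case/orP: (leq_total i i') => le; last rewrite connect_adj_in_sym;
    by apply: connect_h => // k kk; apply: mid; lia.
have mid (k : 'I_n.+2) : nat_of_ord k = j \/ nat_of_ord k = j' -> (i', k) \in X.
  by case=> /val_inj->.
case/orP: (leq_total j j') => le; last rewrite connect_adj_in_sym;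
  by apply: connect_v => // k kk; apply: mid; lia.
Qed.

End Rounding.

Lemma frac_unit k K : (k <= K)%N -> Rlt 0 (INR K) ->
  Rle 0 (INR k / INR K) /\ Rle (INR k / INR K) 1.
Proof.
move=> kK K0; split.
  by apply: Rmult_le_pos; [apply: pos_INR | apply/Rlt_le/Rinv_0_lt_compat].
apply: (Rmult_le_reg_r (INR K)) => //; rewrite /Rdiv Rmult_assoc Rinv_l; last lra.
by rewrite Rmult_1_r Rmult_1_l; apply: le_INR; apply/leP.
Qed.

(** * Choice of the scales for a plane drawing *)

Section PlanarSparse.
Local Open Scope R_scope.
Variables (T : finType) (e : rel T) (p : T -> R * R) (g : T -> T -> R -> R * R).
Hypothesis p_inj : injective p.
Let G x y t := g x y (clamp01 t).
Hypothesis G_cont : forall x y, e x y -> curve_cont (G x y).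
Hypothesis g_src : forall x y, e x y -> g x y 0 = p x.
Hypothesis g_tgt : forall x y, e x y -> g x y 1 = p y.
Hypothesis g_vertex : forall x y, e x y -> forall t z, 0 < t < 1 -> g x y t <> p z.
Hypothesis g_disj : forall x y, e x y ->
  forall x' y', e x' y' -> ~ (x' = x /\ y' = y) -> ~ (x' = y /\ y' = x) ->
  forall t s, 0 < t < 1 -> 0 <= s <= 1 -> g x y t <> g x' y' s.

Lemma G_id x y t : 0 <= t <= 1 -> G x y t = g x y t.
Proof. by move=> t01; rewrite /G clamp01_id. Qed.

Lemma G_0 x y : e x y -> G x y 0 = p x.
Proof. by move=> exy; rewrite G_id ?g_src //; lra. Qed.

Lemma G_1 x y : e x y -> G x y 1 = p y.
Proof. by move=> exy; rewrite G_id ?g_tgt //; lra. Qed.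

(** The factor 4 leaves room for two boxes of radius about [r] and the rounding errors. *)
Lemma vertex_scale : exists r, 0 < r /\
  (forall x y, x <> y -> ~ near (p x) (p y) (4 * r)) /\
  (forall x y z, e x y -> z <> x -> z <> y ->
     forall t, 0 <= t <= 1 -> ~ near (G x y t) (p z) (4 * r)).
Proof.
have [||r1 [r10 H1]] := @finite_pos (T * T)%type
    (fun xy r => xy.1 <> xy.2 -> ~ near (p xy.1) (p xy.2) r).
- by move=> [x y] h h' h0 hh' /= H nxy n; apply: (H nxy); apply: near_le n.
- move=> [x y] /=; have [->|nxy] := eqVneq x y; first by exists 1; split; [lra|].
  have [|r [r0 Hr]] := @neq_not_near (p x) (p y); first by move/p_inj => E; rewrite E eqxx in nxy.
  by exists r.
have [||r2 [r20 H2]] := @finite_pos (T * T * T)%type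
    (fun xyz r => e xyz.1.1 xyz.1.2 -> xyz.2 <> xyz.1.1 -> xyz.2 <> xyz.1.2 ->
       forall t, 0 <= t <= 1 -> ~ near (G xyz.1.1 xyz.1.2 t) (p xyz.2) r).
- move=> [[x y] z] h h' h0 hh' /= H exy zx zy t t01 n.
  by apply: (H exy zx zy t t01); apply: near_le n.
- move=> [[x y] z] /=.
  have [[exy zx zy]|nH] := pselect [/\ e x y, z <> x & z <> y]; last first.
    by exists 1; split; [lra | move=> exy zx zy; case: nH].
  have [|r [r0 Hr]] := @curve_avoid_point (G x y) (p z) (G_cont exy).
    move=> t t01; have [->|t0] := Req_dec t 0.
      by rewrite G_0 // => /p_inj/esym.
    have [->|t1] := Req_dec t 1; first by rewrite G_1 // => /p_inj/esym.
    by rewrite G_id //; apply: g_vertex => //; lra.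
  by exists r.
exists (Rmin r1 r2 / 4); have r0 : 0 < Rmin r1 r2 by apply: Rmin_glb_lt.
have E : 4 * (Rmin r1 r2 / 4) = Rmin r1 r2 by field.
split; [lra | rewrite E; split].
  by move=> x y nxy n; apply: (H1 (x, y) nxy); apply: near_le n; apply: Rmin_l.
move=> x y z exy zx zy t t01 n.
by apply: (H2 (x, y, z) exy zx zy t t01); apply: near_le n; apply: Rmin_r.
Qed.

Lemma edge_scale r : 0 < r -> exists h, 0 < h /\
  forall x y x' y', e x y -> e x' y' -> ~ (x' = x /\ y' = y) -> ~ (x' = y /\ y' = x) ->
  forall t, 0 <= t <= 1 -> ~ near (G x y t) (p x) r -> ~ near (G x y t) (p y) r ->
  forall s, 0 <= s <= 1 -> ~ near (G x y t) (G x' y' s) h.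
Proof.
move=> r0; pose Q (w : T * T * (T * T)) h :=
  let: (x, y, (x', y')) := w in
  e x y -> e x' y' -> ~ (x' = x /\ y' = y) -> ~ (x' = y /\ y' = x) ->
  forall t, 0 <= t <= 1 -> ~ near (G x y t) (p x) r -> ~ near (G x y t) (p y) r ->
  forall s, 0 <= s <= 1 -> ~ near (G x y t) (G x' y' s) h.
have [||h [h0 H]] := @finite_pos _ Q; last first.
- by exists h; split=> // x y x' y'; apply: (H (x, y, (x', y'))).
- move=> [[x y] [x' y']] /=.
  have [[exy exy' n1 n2]|nH] := pselect
    [/\ e x y, e x' y', ~ (x' = x /\ y' = y) & ~ (x' = y /\ y' = x)]; last first.
    by exists 1; split; [lra | move=> *; case: nH].
  have [|h [h0 Hh]] := @curves_separated (G x y) (G x' y') (p x) (p y) r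
    (G_cont exy) (G_cont exy').
    move=> t s t01 s01 nx ny; rewrite !G_id //; apply: g_disj => //.
    have t0 : t <> 0 by move=> E; apply: nx; rewrite E G_0 //; apply: near_refl.
    have t1 : t <> 1 by move=> E; apply: ny; rewrite E G_1 //; apply: near_refl.
    by lra.
  by exists h.
- move=> [[x y] [x' y']] h h' h0 hh' /= H exy exy' n1 n2 t t01 nx ny s s01 n.
  by apply: (H exy exy' n1 n2 t t01 nx ny s s01); apply: near_le n.
Qed.

Lemma drawing_bounded : exists M, 0 < M /\
  (forall x, near (p x) (0, 0) M) /\
  (forall x y, e x y -> forall t, 0 <= t <= 1 -> near (G x y t) (0, 0) M).
Proof.
have bp x : exists h, 0 < h /\ near (p x) (0, 0) (/ h).
  have [|h [h0 Hh]] := @curve_bounded (fun=> p x).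
    by move=> t eps eps0; exists 1; split; [lra | move=> s _; apply: near_refl].
  by exists h; split=> //; apply: (Hh 0); lra.
have [|h1 [h10 H1]] := finite_pos _ bp.
  by move=> x h h' h0 hh'; apply: near_le; apply: Rinv_le_contravar.
have [||h2 [h20 H2]] := @finite_pos (T * T)%type (fun xy h => e xy.1 xy.2 ->
    forall t, 0 <= t <= 1 -> near (G xy.1 xy.2 t) (0, 0) (/ h)).
- move=> [x y] h h' h0 hh' /= H exy t t01; apply: near_le (H exy t t01).
  exact: Rinv_le_contravar.
- move=> [x y] /=; have [exy|] := boolP (e x y); last by exists 1; split; [lra|].
  by have [h [h0 Hh]] := curve_bounded (G_cont exy); exists h.
have i1 := Rinv_0_lt_compat _ h10; have i2 := Rinv_0_lt_compat _ h20.
exists (/ h1 + / h2); split; [lra | split].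
  by move=> x; apply: near_le (H1 x); lra.
by move=> x y exy t t01; apply: near_le (H2 (x, y) exy t t01); lra.
Qed.

Lemma edges_uniform_cont eps : 0 < eps -> exists K : nat, 0 < INR K /\
  forall x y, e x y -> forall k, (k < K)%N ->
    near (G x y (INR k.+1 / INR K)) (G x y (INR k / INR K)) eps.
Proof.
move=> eps0.
have [||d [d0 H]] := @finite_pos (T * T)%type (fun xy d => e xy.1 xy.2 ->
    forall t s, 0 <= t <= 1 -> 0 <= s <= 1 -> - d < s - t < d ->
    near (G xy.1 xy.2 s) (G xy.1 xy.2 t) eps).
- move=> [x y] h h' h0 hh' /= H exy t s t01 s01 st; apply: H => //; lra.
- move=> [x y] /=; have [exy|] := boolP (e x y); last by exists 1; split; [lra|].
  by have [d [d0 Hd]] := curve_uniform_cont (G_cont exy) eps0; exists d.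
have [K [Kd K0]] := archimed_cor1 d d0.
have K0' : 0 < INR K by apply: lt_0_INR.
exists K; split=> // x y exy k kK; apply: (H (x, y) exy).
- by apply: frac_unit => //; apply: ltnW.
- exact: frac_unit.
- have -> : INR k.+1 / INR K - INR k / INR K = / INR K by rewrite S_INR; field; lra.
  by have := Rinv_0_lt_compat _ K0'; lra.
Qed.

Hypothesis e_simple : simple_graph e.
Hypothesis e_girth : girth_at_least e 8.

Lemma drawing_sparse (x0 : T) : (3 * (\sum_x #|[set y | e x y]|) < 8 * #|T|)%N.
Proof.
have [r [r0 [pp_far Gp_far]]] := vertex_scale.
have [eta [eta0 GG_far]] := @edge_scale (r / 2) ltac:(lra).
have [M [M0 [pM GM]]] := drawing_bounded.
(* [K8] is the radius of a box in grid steps; the mesh [h = r / K8] is then below both [r / 8] and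
   [eta / 4]. *)
have [K8 [K8lt K80]] := archimed_cor1 (Rmin (/ 8) (eta / (4 * r)))
  ltac:(apply: Rmin_glb_lt; [lra | apply: Rdiv_lt_0_compat; lra]).
have K80' : 0 < INR K8 by apply: lt_0_INR.
pose h := r / INR K8.
have hK : INR K8 * h = r by rewrite /h; field; lra.
have h0 : 0 < h by apply: Rdiv_lt_0_compat.
have h8 : 8 * h < r.
  have le := Rmin_l (/ 8) (eta / (4 * r)); rewrite -[X in _ < X]hK.
  apply: Rmult_lt_compat_r => //; rewrite -[INR K8]Rinv_inv -[8]Rinv_inv.
  apply: Rinv_lt_contravar; last lra.
  by apply: Rmult_lt_0_compat; [apply: Rinv_0_lt_compat | lra].
have h_eta : 4 * h < eta.
  have := Rmin_r (/ 8) (eta / (4 * r)) => le.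
  have : / INR K8 * (4 * r) < eta / (4 * r) * (4 * r).
    by apply: Rmult_lt_compat_r; lra.
  have -> : eta / (4 * r) * (4 * r) = eta by field; lra.
  by rewrite /h /Rdiv; lra.
have [n nM] : exists n, 2 * M < INR n * h.
  have [n n1] := INR_unbounded (2 * M / h); exists n.
  have E : 2 * M / h * h = 2 * M by field; lra.
  by rewrite -E; apply: Rmult_lt_compat_r.
have [K [K0 GK]] := edges_uniform_cont h0.
pose rd := @grid_round h M n; pose pos := @torus_pos h M n.
pose c x := rd (p x).
(* Boxes are truncated at 1 to avoid row and column 0; a corridor consists of the grid points within
   [2 * h] of the arc. *)
pose B x := rect n (maxn 1 ((c x).1 - K8)) ((c x).1 + K8) (maxn 1 ((c x).2 - K8)) ((c x).2 + K8).
pose W x y := [set q : torus n | [&& (0 < q.1)%N, (0 < q.2)%N &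
  `[< exists t, 0 <= t <= 1 /\ near (pos q) (G x y t) (2 * h) >]]].
have cpos x : near (pos (c x)) (p x) (2 * h) := grid_round_near h0 nM (pM x).
have cgt0 x := grid_round_gt0 h0 nM (pM x); rewrite -/rd -/(c _) in cgt0.
have WP x y q : q \in W x y -> exists t, 0 <= t <= 1 /\ near (pos q) (G x y t) (2 * h).
  by rewrite inE => /and3P[_ _ /asboolP].
have Bpos x (q : torus n) : q \in B x -> near (pos q) (p x) (r + 3 * h).
  rewrite inE; move: (c x) (cpos x) => cx ncx /andP[/andP[l1 u1] /andP[l2 u2]].
  have := grid_pos_le M h0 u1; have := grid_pos_le M h0 u2.
  have : (cx.1 <= q.1 + K8)%N by lia.
  have : (cx.2 <= q.2 + K8)%N by lia.
  move=> /(grid_pos_le M h0) h1 /(grid_pos_le M h0) h2 h3 h4.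
  by rewrite hK in h1 h2 h3 h4; move: ncx; rewrite /near /pos /torus_pos /=; lra.
have posB x (q : torus n) : (0 < q.1)%N -> (0 < q.2)%N ->
    near (pos q) (p x) (r - 2 * h) -> q \in B x.
  move=> q1 q2; rewrite inE; move: (c x) (cpos x) => cx ncx.
  move=> /near_trans/(_ (near_sym ncx)); rewrite /near /pos /torus_pos /=.
  move=> [[h1 h2] [h3 h4]]; have ltK := @grid_pos_lt h M h0 _ _ K8; rewrite hK in ltK.
  have /ltK : grid_pos h M q.1 < grid_pos h M cx.1 + r by lra.
  have /ltK : grid_pos h M q.2 < grid_pos h M cx.2 + r by lra.
  have /ltK : grid_pos h M cx.1 < grid_pos h M q.1 + r by lra.
  have /ltK : grid_pos h M cx.2 < grid_pos h M q.2 + r by lra.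
  by lia.
have ctrB x : c x \in B x.
  by have [c1 c2] := cgt0 x; rewrite inE; rewrite -/(c x) in c1 c2; lia.
apply: (@discrete_drawing_sparse T e n e_simple c B W) => //.
- by move=> x q; rewrite inE -!val_eqE /= -!lt0n; lia.
- by move=> x y q; rewrite inE -!val_eqE /= -!lt0n => /and3P[-> ->].
- move=> x y q /Bpos qx /Bpos qy; apply: contrapT => nxy.
  by apply: (pp_far x y nxy); apply: near_le (near_trans (near_sym qx) qy); lra.
- by move=> x q qx; apply: rect_conn (ctrB x) qx.
- move=> x y exy.
  (* The arc is followed in [K] steps of length below [h], each rounded by [grid_round_step]. *)
  have step k : (k <= K)%N -> connect (adj_in (W x y)) (c x) (rd (G x y (INR k / INR K))).
    elim: k => [_|k IH kK].
      by rewrite /= /Rdiv Rmult_0_l G_0 // connect0.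
    apply: connect_trans (IH (ltnW kK)) _.
    have t01 := frac_unit (ltnW kK) K0.
    apply: (grid_round_step h0 nM); [exact: GM | | exact: GK |].
      by apply: GM => //; apply: frac_unit.
    by move=> q q1 q2 nq; rewrite inE q1 q2; apply/asboolP; exists (INR k / INR K).
  by have := step K (leqnn K); rewrite /Rdiv Rinv_r ?G_1 //; lra.
- move=> x y z q exy /WP[t [t01 qt]] /Bpos qz.
  have [->|zx] := pselect (z = x); first by left.
  have [->|zy] := pselect (z = y); first by right.
  case: (Gp_far x y z exy zx zy t t01).
  by apply: near_le (near_trans (near_sym qt) qz); lra.
(* A common grid point puts the two arcs within [4 * h < eta] of each other; outside the boxes the
   first arc is not within [r / 2] of its ends, so [GG_far] applies. *)
- move=> x y x' y' q exy exy' qW qW' qx qy; apply: contrapT => nxy.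
  have [t [t01 qt]] := WP _ _ _ qW; have [s [s01 qs]] := WP _ _ _ qW'.
  have [q1 q2] : (0 < q.1)%N /\ (0 < q.2)%N by move: qW; rewrite inE => /and3P[].
  have far z : q \notin B z -> ~ near (G x y t) (p z) (r / 2).
    move=> /negP qz nz; apply: qz; apply: posB => //.
    by apply: near_le (near_trans qt nz); lra.
  apply: (GG_far x y x' y' exy exy' _ _ t t01 (far _ qx) (far _ qy) s s01).
  - by move=> E; apply: nxy; left.
  - by move=> E; apply: nxy; right.
  - by apply: near_le (near_trans (near_sym qt) qs); lra.
Qed.
End PlanarSparse.

Lemma planar_sparse (T : finType) (e : rel T) (x0 : T) :
  simple_graph e -> planar e -> girth_at_least e 8 ->
  3 * (\sum_x #|[set y | e x y]|) < 8 * #|T|.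
Proof.
move=> se [p [g [p_inj H]]] g8; apply: (drawing_sparse p_inj (g := g)) => //.
- by move=> x y /H[c1 [c2 _]]; apply: curve_contP.
- by move=> x y /H[_ [_ [E _]]].
- by move=> x y /H[_ [_ [_ [E _]]]].
- by move=> x y /H[_ [_ [_ [_ [_ [_ [E _]]]]]]].
- by move=> x y /H[_ [_ [_ [_ [_ [_ [_ E]]]]]]].
Qed.

(** * Passage to induced subgraphs and the upper bound *)

Section InducedSubgraph.
Variables (T : finType) (e : rel T) (X : {set T}).

Definition induced : rel {x | x \in X} := fun a b => e (val a) (val b).

Lemma induced_simple : simple_graph e -> simple_graph induced.
Proof. by move=> [e_sym e_irr]; split=> [a b|a]; [apply: e_sym | apply: e_irr]. Qed.

Lemma induced_planar : planar e -> planar induced.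
Proof.
move=> [p [g [p_inj H]]]; exists (p \o val), (fun a b => g (val a) (val b)).
split=> [a b /p_inj/val_inj//|a b eab].
have [c1 [c2 [g0 [g1 [gr [gi [gv gd]]]]]]] := H _ _ eab.
do 7![split=> //]; first by move=> t z; apply: gv.
by move=> a' b' eab' n1 n2; apply: gd => // -[/val_inj Ea /val_inj Eb]; [apply: n1 | apply: n2].
Qed.

Lemma induced_girth k : girth_at_least e k -> girth_at_least induced k.
Proof.
move=> gk s us cs s3; have := gk (map val s); rewrite map_inj_uniq; last exact: val_inj.
by rewrite size_map cycle_map; apply.
Qed.

Lemma sum_induced_deg :
  \sum_a #|[set b | induced a b]| = \sum_(x in X) #|nbrs e X x|.
Proof.
rewrite [RHS]big_sub; apply: eq_bigr => a _.
rewrite -(card_imset _ val_inj); apply: eq_card => y; rewrite in_nbrs.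
apply/imsetP/andP => [[b]|[yX ey]]; first by rewrite inE => eab ->; split=> //; apply: valP.
by exists (Sub y yX); rewrite ?inE.
Qed.

End InducedSubgraph.

Lemma planar_girth8_push_colorable (T : finType) (e o : rel T) :
  in_P8 e -> orientation_of e o -> push_colorable o 4.
Proof.
move=> [se [pe ge]] ori; apply: (sparse_push_colorable (proj1 se) (proj2 se) ori) => X.
move=> /set0Pn[x xX]; rewrite -sum_induced_deg -[in 8 * _]card_sig.
apply: planar_sparse; [exact: exist _ x xX | exact: induced_simple | exact: induced_planar |].
exact: induced_girth.
Qed.

(** * The lower bound *)

Section ClosedWalks.
Variables (U : finType) (a : rel U).
Hypothesis U3 : #|U| <= 3.
Hypothesis a_oriented : oriented a.

(* On at most three vertices a closed walk of length 4 retraces its edges. *)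
Lemma closed_walk4_even (c0 c1 c2 c3 : U) :
  a c0 c1 || a c1 c0 -> a c1 c2 || a c2 c1 -> a c2 c3 || a c3 c2 -> a c3 c0 || a c0 c3 ->
  ~~ (a c0 c1 (+) a c1 c2 (+) a c2 c3 (+) a c3 c0).
Proof.
move=> h01 h12 h23 h30; have [a_irr a_asym] := a_oriented.
have opp c d : a c d || a d c -> a d c = ~~ a c d.
  by case: (boolP (a c d)) => [/a_asym/negbTE|//].
have neq c d : a c d || a d c -> c != d.
  by apply: contraTneq => ->; rewrite a_irr.
have [<-|n02] := eqVneq c0 c2.
  rewrite (opp c0 c1) // (opp c3 c0) //.
  by case: (a c0 c1); case: (a c3 c0).
have [<-|n13] := eqVneq c1 c3.
  rewrite (opp c0 c1) // (opp c1 c2) //.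
  by case: (a c0 c1); case: (a c1 c2).
have /card_uniqP u4 : uniq [:: c0; c1; c2; c3].
  by rewrite /= !inE !negb_or (neq _ _ h01) n02 (neq _ _ h12) n13 (neq _ _ h23) eq_sym (neq _ _ h30).
by have := max_card (mem [:: c0; c1; c2; c3]); rewrite u4 => /leq_trans/(_ U3).
Qed.

Variables (T : finType) (o : rel T) (S : {set T}) (phi : T -> U).
Hypothesis phi_hom : hom (push o S) a phi.

Lemma hom_push_arc u v : o u v ->
  a (phi u) (phi v) = ~~ ((u \in S) (+) (v \in S)) /\
  a (phi v) (phi u) = (u \in S) (+) (v \in S).
Proof.
move=> ouv; have [_ a_asym] := a_oriented.
have := phi_hom (x := u) (y := v); have := phi_hom (x := v) (y := u).
rewrite /push [(v \in S) (+) _]addbC; case: ((u \in S) (+) (v \in S)) => h h'.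
  by have {}h := h ouv; rewrite h (negbTE (a_asym _ _ h)).
by have {}h' := h' ouv; rewrite h' (negbTE (a_asym _ _ h')).
Qed.

(** The paths have 4 and 3 forward arcs. Pushing an inner vertex preserves the parity on its path,
    and pushing [x] or [y] changes both parities, so they stay different; equal images would make
    both even. *)
Lemma lens_neq x y b0 b1 b2 c0 c1 c2 :
  o x b0 -> o b0 b1 -> o b1 b2 -> o b2 y ->
  o x c0 -> o c0 c1 -> o c1 c2 -> o y c2 -> phi x != phi y.
Proof.
move=> /hom_push_arc[p1 q1] /hom_push_arc[p2 q2] /hom_push_arc[p3 q3] /hom_push_arc[p4 q4].
move=> /hom_push_arc[p5 q5] /hom_push_arc[p6 q6] /hom_push_arc[p7 q7] /hom_push_arc[p8 q8].
apply/eqP => E.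
have := @closed_walk4_even (phi x) (phi b0) (phi b1) (phi b2).
have := @closed_walk4_even (phi x) (phi c0) (phi c1) (phi c2).
rewrite -E in p4 q4 p8 q8; rewrite p1 p2 p3 p4 p5 p6 p7 p8 q1 q2 q3 q4 q5 q6 q7 q8.
do 4![case: (_ \in S)]; case: (_ \in S); case: (_ \in S); case: (_ \in S); case: (_ \in S);
  by move=> /(_ isT isT isT isT) h1 /(_ isT isT isT isT) h2.
Qed.
End ClosedWalks.

Definition lens (i j b : nat) : seq (nat * nat) :=
  [:: (i, b); (b, b.+1); (b.+1, b.+2); (b.+2, j);
      (i, b + 3); (b + 3, b + 4); (b + 4, b + 5); (j, b + 5)].

(** Vertices 0 to 3 are those of [K_4]; each of the six lenses owns six consecutive inner vertices,
    which makes 40 in all. *)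
Definition K4_arcs : seq (nat * nat) :=
  lens 0 1 4 ++ lens 0 2 10 ++ lens 0 3 16 ++ lens 1 2 22 ++ lens 1 3 28 ++ lens 2 3 34.

Definition K4_edges : seq (nat * nat) := K4_arcs ++ [seq (p.2, p.1) | p <- K4_arcs].

Definition lens_o : rel 'I_40 := fun x y => (nat_of_ord x, nat_of_ord y) \in K4_arcs.
Definition lens_e : rel 'I_40 := fun x y => (nat_of_ord x, nat_of_ord y) \in K4_edges.

Lemma mem_swap (p q : nat) (s : seq (nat * nat)) :
  ((p, q) \in [seq (r.2, r.1) | r <- s]) = ((q, p) \in s).
Proof.
apply/mapP/idP => [[[u v] h [-> ->]]//|h]; by exists (q, p).
Qed.

Lemma lens_eE x y : lens_e x y = lens_o x y || lens_o y x.
Proof. by rewrite /lens_e mem_cat mem_swap. Qed.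

Lemma lens_o_asym x y : lens_o x y -> ~~ lens_o y x.
Proof.
have /allP H : all (fun p => (p.2, p.1) \notin K4_arcs) K4_arcs by vm_compute.
by move=> /H.
Qed.

Lemma lens_simple : simple_graph lens_e.
Proof.
split=> [x y|x]; first by rewrite !lens_eE orbC.
by rewrite lens_eE orbb; apply/negbTE/negP => xx; move/negP: (lens_o_asym xx); apply.
Qed.

Lemma lens_orientation : orientation_of lens_e lens_o.
Proof.
move=> x y; rewrite lens_eE; split=> [->//|].
by case: (boolP (lens_o x y)) => [/lens_o_asym/negbTE->|_ /= ->].
Qed.

Lemma lens_not_colorable : ~ push_colorable lens_o 3.
Proof.
move=> [U [a [U3 [a_or [S [phi phi_hom]]]]]].
have neq i j b : i < 40 -> j < 40 -> b + 5 < 40 -> all (mem K4_arcs) (lens i j b) ->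
    phi (inord i) != phi (inord j).
  move=> i40 j40 b40 /allP H.
  have oP p q : (p, q) \in lens i j b -> p < 40 -> q < 40 ->
      lens_o (inord p) (inord q).
    by move=> /H h p40 q40; rewrite /lens_o !inordK.
  apply: (lens_neq U3 a_or phi_hom (b0 := inord b) (b1 := inord b.+1) (b2 := inord b.+2)
    (c0 := inord (b + 3)) (c1 := inord (b + 4)) (c2 := inord (b + 5)));
    by apply: oP; rewrite ?inE ?eqxx ?orbT //; lia.
have /card_uniqP u4 : uniq [seq phi (inord i) | i <- iota 0 4].
  rewrite /= !inE !negb_or (neq 0 1 4) // (neq 0 2 10) // (neq 0 3 16) //.
  by rewrite (neq 1 2 22) // (neq 1 3 28) // (neq 2 3 34).
have := max_card (mem [seq phi (inord i) | i <- iota 0 4]).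
by rewrite u4 => /leq_trans/(_ U3).
Qed.

(** * Girth of the lower-bound graph *)

Definition K4_nbrs (i : nat) : seq nat := [seq p.2 | p <- K4_edges & p.1 == i].

(** A bounded search: no walk that never turns back immediately, having come from [prev] to [cur],
    reaches [start] within [f] further steps. *)
Fixpoint no_return (start f prev cur : nat) : bool :=
  if f is f'.+1 then
    all (fun z => (z == prev) || (z != start) && no_return start f' cur z) (K4_nbrs cur)
  else true.

Definition K4_rel : rel nat := fun i j => (i, j) \in K4_edges.

(** The condition for empty [r] excludes going back along the edge just traversed, which the search
    ignores. *)
Lemma no_returnP start f prev cur r : no_return start f prev cur ->
  path K4_rel cur r -> uniq [:: prev, cur & r] -> start \notin cur :: r ->
  (r = [::] -> start != prev) -> size r < f -> ~~ K4_rel (last cur r) start.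
Proof.
elim: r f prev cur => [|z r IH] [|f] prev cur //= /allP H.
  move=> _ _ _ /(_ erefl) sp _; apply/negP => e_cs.
  have /H : start \in K4_nbrs cur.
    by apply/mapP; exists (cur, start); rewrite ?mem_filter ?eqxx.
  by rewrite (negbTE sp) eqxx.
move=> /andP[ecz pz] /and3P[u1 u2 u3] ns _ szf.
have /H : z \in K4_nbrs cur by apply/mapP; exists (cur, z); rewrite ?mem_filter ?eqxx.
have zp : z != prev by apply: contraNneq u1 => ->; rewrite !inE eqxx orbT.
rewrite (negbTE zp) /= => /andP[zs nr].
have /and3P[sc sz sr] : [&& start != cur, start != z & start \notin r].
  by move: ns; rewrite !in_cons !negb_or.
apply: (IH f cur z nr pz) => //; first by rewrite /= u2.
by rewrite inE negb_or sz.
Qed.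

(** A cycle on at most seven vertices returns to [x] at most six steps after its first edge. *)
Lemma K4_no_return x y : x < 40 -> K4_rel x y -> no_return x 6 x y.
Proof.
move=> x40 exy.
have /allP chk : all (fun x => all (no_return x 6 x) (K4_nbrs x)) (iota 0 40) by vm_compute.
have /allP := chk x (etrans (mem_iota 0 40 x) x40); apply.
by apply/mapP; exists (x, y); rewrite ?mem_filter ?eqxx.
Qed.

Lemma K4_girth (s : seq nat) : all (gtn 40) s -> uniq s -> cycle K4_rel s ->
  3 <= size s -> 8 <= size s.
Proof.
case: s => [|x [|y [|z s]]] //.
move=> /andP[x40 _] us; rewrite /cycle rcons_path => /andP[/andP[exy pyz] elast] _.
rewrite leqNgt; apply/negP => s8; move: elast; apply/negP.
have us' := us; rewrite cons_uniq in us'; case/andP: us' => nx _.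
by apply: (no_returnP (r := z :: s) (K4_no_return x40 exy) pyz us nx).
Qed.

Lemma lens_girth : girth_at_least lens_e 8.
Proof.
move=> s us cs s3; rewrite -(size_map (@nat_of_ord 40)); apply: K4_girth.
- by rewrite all_map; apply/allP => x _; apply: ltn_ord.
- by rewrite map_inj_uniq //; apply: ord_inj.
- by rewrite cycle_map.
- by rewrite size_map.
Qed.

(** * Straight-line drawings *)

Section StraightLineDrawing.
Local Open Scope R_scope.

Definition segment (a b : R * R) (t : R) : R * R :=
  (a.1 + t * (b.1 - a.1), a.2 + t * (b.2 - a.2)).

(* Twice the signed area of the triangle [a b q]. *)
Definition area (a b q : R * R) : R :=
  (b.1 - a.1) * (q.2 - a.2) - (b.2 - a.2) * (q.1 - a.1).

Lemma area_self a b t : area a b (segment a b t) = 0.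
Proof. by rewrite /area /segment /=; ring. Qed.

Lemma area_segment a b c d s :
  area a b (segment c d s) = (1 - s) * area a b c + s * area a b d.
Proof. by rewrite /area /segment /=; ring. Qed.

Lemma segment0 a b : segment a b 0 = a.
Proof. by case: a => a1 a2; rewrite /segment /=; congr (_, _); ring. Qed.

Lemma segment1 a b : segment a b 1 = b.
Proof. by case: b => b1 b2; rewrite /segment /=; congr (_, _); ring. Qed.

Lemma segment_rev a b t : segment b a t = segment a b (1 - t).
Proof. by rewrite /segment; congr (_, _); ring. Qed.

Lemma segment_inj a b t s : a <> b -> segment a b t = segment a b s -> t = s.
Proof.
case: a b => [a1 a2] [b1 b2] nab [] /= E1 E2.
have [F1|n1] := Req_dec a1 b1; last by apply: (Rmult_eq_reg_r (b1 - a1)); lra.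
have n2 : a2 <> b2 by move=> F2; apply: nab; rewrite F1 F2.
by apply: (Rmult_eq_reg_r (b2 - a2)); lra.
Qed.

Lemma convex_comb_neq0 u v s : 0 <= s <= 1 -> 0 < u * v -> (1 - s) * u + s * v <> 0.
Proof.
move=> s01 uv; have [u0|u0] := Rlt_le_dec u 0.
  have v0 : v < 0 by nra.
  by nra.
have v0 : 0 < v by nra.
have u0' : 0 < u by nra.
by nra.
Qed.

Lemma segments_disjoint_sides a b c d t s : 0 <= s <= 1 ->
  0 < area a b c * area a b d -> segment a b t <> segment c d s.
Proof.
move=> s01 /(convex_comb_neq0 s01) H E; apply: H.
by rewrite -area_segment -E area_self.
Qed.

Lemma segments_disjoint_common a b d t s : 0 < t < 1 -> a <> b ->
  area a b d <> 0 -> segment a b t <> segment a d s.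
Proof.
move=> t01 nab nd E; have := area_segment a b a d s; rewrite -E area_self.
have -> : area a b a = 0 by rewrite /area; ring.
move=> Es; have s0 : s = 0 by apply: (Rmult_eq_reg_r (area a b d)); lra.
rewrite s0 segment0 -[X in _ = X](segment0 a b) in E.
by have := segment_inj nab E; lra.
Qed.

Lemma clamp01_cases t : (t <= 0 /\ clamp01 t = 0) \/ (0 <= t <= 1 /\ clamp01 t = t) \/
  (1 <= t /\ clamp01 t = 1).
Proof.
have [t0|t0] := Rle_lt_dec t 0.
  by left; split=> //; rewrite /clamp01 Rmin_right ?Rmax_left //; have := Rle_0_1; lra.
have [t1|t1] := Rle_lt_dec t 1; right; [left|right]; split; try lra.
  by rewrite /clamp01 Rmin_right // Rmax_right //; lra.
by rewrite /clamp01 Rmin_left ?Rmax_right //; [apply: Rle_0_1 | lra].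
Qed.

Lemma clamp01_continuity : continuity clamp01.
Proof.
move=> t eps eps0; exists eps; split=> // s [_ st].
apply: Rle_lt_trans st; rewrite /dist /= /Rdist /Rabs.
by case: (clamp01_cases t) => [[]|[[]|[]]] ? ->; case: (clamp01_cases s) => [[]|[[]|[]]] ? ->;
  do 2?[case: Rcase_abs => ?]; lra.
Qed.

Lemma affine_clamp_continuity u v : continuity (fun t => u + clamp01 t * v).
Proof.
apply: continuity_plus; first exact: continuity_const.
apply: continuity_mult; first exact: clamp01_continuity.
exact: continuity_const.
Qed.

(** A criterion by signs of areas: non-collinearity handles vertices and edges with a common end,
    and for two disjoint edges one lies strictly on one side of the line through the other. *)
Lemma straight_line_planar (T : finType) (e : rel T) (p : T -> R * R) :
  injective p -> symmetric e -> irreflexive e ->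
  (forall x y z, e x y -> z <> x -> z <> y -> area (p x) (p y) (p z) <> 0) ->
  (forall x y x' y', e x y -> e x' y' -> x <> x' -> x <> y' -> y <> x' -> y <> y' ->
     0 < area (p x) (p y) (p x') * area (p x) (p y) (p y') \/
     0 < area (p x') (p y') (p x) * area (p x') (p y') (p y)) ->
  planar e.
Proof.
move=> p_inj e_sym e_irr col sep; exists p, (fun x y => segment (p x) (p y)); split=> // x y exy.
have npq : p x <> p y by move=> /p_inj E; rewrite E e_irr in exy.
have nxy : x <> y by move=> E; apply: npq; rewrite E.
split; first exact: affine_clamp_continuity.
split; first exact: affine_clamp_continuity.
split; first exact: segment0.
split; first exact: segment1.
split; first by move=> t _; apply: segment_rev.
split; first by move=> t s _ _; apply: segment_inj.
split.
  move=> t z t01 E.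
  have [Ez|nzx] := pselect (z = x).
    by move: E; rewrite Ez -[X in _ = X](segment0 _ (p y)) => /(segment_inj npq); lra.
  have [Ez|nzy] := pselect (z = y).
    by move: E; rewrite Ez -[X in _ = X](segment1 (p x)) => /(segment_inj npq); lra.
  by apply: (col x y z exy nzx nzy); rewrite -E area_self.
move=> x' y' exy' n1 n2 t s t01 s01.
have nxy' : x' <> y' by move=> E; rewrite E e_irr in exy'.
have s01' : 0 <= 1 - s <= 1 by lra.
have t01' : 0 < 1 - t < 1 by lra.
have [Exx|nxx] := pselect (x' = x).
  rewrite Exx; apply: segments_disjoint_common => //; apply: col => // E; last by apply: n1.
  by apply: nxy'; rewrite E.
have [Exy|nxy''] := pselect (x' = y).
  rewrite segment_rev Exy; apply: segments_disjoint_common => //; first exact: not_eq_sym.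
  by apply: col => [|E|E]; [rewrite e_sym | apply: nxy'; rewrite E | apply: n2].
have [Eyx|nyx] := pselect (y' = x).
  rewrite [segment (p x') _ _]segment_rev Eyx; apply: segments_disjoint_common => //.
  by apply: col => // E; apply: n2.
have [Eyy|nyy] := pselect (y' = y).
  rewrite [segment (p x') _ _]segment_rev segment_rev Eyy.
  apply: segments_disjoint_common => //; first exact: not_eq_sym.
  by apply: col; rewrite // e_sym.
case: (sep x y x' y' exy exy') => //; try exact: not_eq_sym.
  exact: segments_disjoint_sides.
move=> h E; apply: (segments_disjoint_sides (t := s) _ h (esym E)).
by lra.
Qed.

End StraightLineDrawing.

(** * A drawing of the lower-bound graph with integer coordinates *)

Section LensDrawing.
Local Open Scope Z_scope.

(** A triangle with an inner vertex, followed by six points for each lens in the order of [K4_arcs],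
    three along either side of the replaced edge. *)
Definition K4_points : seq (Z * Z) :=
  [:: (0, 0); (48, 0); (24, 48); (24, 16);
      (13, 1); (24, 2); (35, 1); (13, -2); (24, -3); (36, -1);
      (4, 13); (9, 25); (16, 38); (8, 11); (15, 23); (20, 34);
      (5, 6); (10, 11); (16, 14); (7, 1); (14, 5); (19, 11);
      (41, 12); (33, 24); (29, 34); (44, 13); (39, 25); (33, 36);
      (41, 2); (33, 4); (28, 10); (44, 6); (38, 11); (30, 14);
      (26, 40); (27, 32); (26, 25); (23, 40); (21, 33); (23, 25)].

Definition K4_point (i : nat) : Z * Z := nth (0, 0) K4_points i.

(** An integer version of [area], so that the sign conditions are decided by computation. *)
Definition zarea (i j k : nat) : Z :=
  let a := K4_point i in let b := K4_point j in let q := K4_point k in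
  (b.1 - a.1) * (q.2 - a.2) - (b.2 - a.2) * (q.1 - a.1).

Definition lens_pos (x : 'I_40) : R * R := (IZR (K4_point x).1, IZR (K4_point x).2).

Lemma area_lens_pos x y z : area (lens_pos x) (lens_pos y) (lens_pos z) = IZR (zarea x y z).
Proof. by rewrite /area /zarea /= minus_IZR !mult_IZR !minus_IZR. Qed.

Lemma lens_pos_inj : injective lens_pos.
Proof.
move=> x y [/eq_IZR E1 /eq_IZR E2].
have /allP chk : all (fun i => all (fun j => (i == j) ||
  ~~ (Z.eqb (K4_point i).1 (K4_point j).1 && Z.eqb (K4_point i).2 (K4_point j).2))
    (iota 0 40)) (iota 0 40) by vm_compute.
have in40 (z : 'I_40) : nat_of_ord z \in iota 0 40 by rewrite mem_iota ltn_ord.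
have /allP/(_ _ (in40 y)) := chk _ (in40 x); rewrite E1 E2 !Z.eqb_refl orbF.
by move/eqP/val_inj.
Qed.

Lemma zarea_neq0 x y z : lens_e x y -> z <> x -> z <> y -> zarea x y z <> 0.
Proof.
move=> exy zx zy.
have /allP/(_ _ exy)/allP chk : all (fun e => all (fun k => [|| k == e.1, k == e.2 |
   ~~ Z.eqb (zarea e.1 e.2 k) 0]) (iota 0 40)) K4_edges by vm_compute.
have := chk z; rewrite mem_iota ltn_ord => /(_ isT).
case/or3P=> /=; [by move/eqP/val_inj | by move/eqP/val_inj |].
by move/negP => H E; apply: H; rewrite E.
Qed.

Lemma zarea_separated x y x' y' : lens_e x y -> lens_e x' y' ->
  x <> x' -> x <> y' -> y <> x' -> y <> y' ->
  0 < zarea x y x' * zarea x y y' \/ 0 < zarea x' y' x * zarea x' y' y.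
Proof.
move=> exy exy' n1 n2 n3 n4.
have /allP/(_ _ exy)/allP/(_ _ exy') : all (fun e => all (fun e' =>
   [|| e.1 == e'.1, e.1 == e'.2, e.2 == e'.1, e.2 == e'.2,
       Z.ltb 0 (zarea e.1 e.2 e'.1 * zarea e.1 e.2 e'.2) |
       Z.ltb 0 (zarea e'.1 e'.2 e.1 * zarea e'.1 e'.2 e.2)])
   K4_edges) K4_edges by vm_compute.
case/or4P=> /= [/eqP/val_inj//|/eqP/val_inj//|/eqP/val_inj//|].
by case/or3P=> [/eqP/val_inj//|/Z.ltb_lt|/Z.ltb_lt]; [left | right].
Qed.

Lemma lens_planar : planar lens_e.
Proof.
have [e_sym e_irr] := lens_simple.
apply: (straight_line_planar lens_pos_inj e_sym e_irr) => [x y z|x y x' y'].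
  move=> exy zx zy; rewrite area_lens_pos => /eq_IZR_R0.
  exact: zarea_neq0.
move=> exy exy' n1 n2 n3 n4; rewrite !area_lens_pos -!mult_IZR.
by case: (zarea_separated exy exy' n1 n2 n3 n4) => h; [left | right]; apply: IZR_lt.
Qed.

End LensDrawing.

(* chi_p(P_8) = 4: every orientation of every graph in P_8 has push
   chromatic number <= 4, and some orientation of some graph in P_8 has
   push chromatic number > 3. *)
Theorem theorem5 :
  (forall (T : finType) (e : rel T), in_P8 e ->
     forall o : rel T, orientation_of e o -> push_colorable o 4)
  /\
  (exists (T : finType) (e : rel T), in_P8 e /\
     exists o : rel T, orientation_of e o /\ ~ push_colorable o 3).
Proof.
split=> [T e eP8 o|]; first exact: planar_girth8_push_colorable.
exists 'I_40, lens_e; split.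
  by split; [exact: lens_simple | split; [exact: lens_planar | exact: lens_girth]].
by exists lens_o; split; [exact: lens_orientation | exact: lens_not_colorable].
Qed.
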